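(* Let $k\ge 3$ be fixed and $n\ge 3k\binom{2k}{k}$. Let $\mathcal{F}\subset\binom{[n]}{k}$ be a family that is $(3,2k)$-conditionally intersecting but not intersecting. Then $|\mathcal{F}|\le\binom{n-k-1}{k-1}+1$.
   Context: $[n]=\{1,\ldots,n\}$, and $\binom{[n]}{k}$ denotes the collection of all $k$-element subsets of $[n]$. A family $\mathcal{F}\subset\binom{[n]}{k}$ is called $(d,s)$-conditionally intersecting if there do not exist $d$ distinct sets $A_1,\ldots,A_d\in\mathcal{F}$ with $|A_1\cup\cdots\cup A_d|\le s$ and $A_1\cap\cdots\cap A_d=\emptyset$; here $d=3$ and $s=2k$. A family is intersecting if every two of its members have nonempty intersection. *)

(* Defs.v *)
From mathcomp Require Import all_boot.

Set Implicit Arguments.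
Unset Strict Implicit.
Unset Printing Implicit Defensive.

(* The ground set [n] = {1, ..., n} is represented by 'I_n = {0, ..., n - 1}. *)
Definition ksubsets (n k : nat) : {set {set 'I_n}} :=
  [set A : {set 'I_n} | #|A| == k].

Definition conditionally_intersecting (d s n : nat)
    (F : {set {set 'I_n}}) : Prop :=
  ~ exists A : 'I_d -> {set 'I_n},
      [/\ injective A,
          forall i, A i \in F,
          #|\bigcup_(i < d) A i| <= s
        & \bigcap_(i < d) A i = set0].

(* A and B need not be distinct: this only excludes set0 from F, which is
   automatic for a family of k-sets with k > 0. *)
Definition intersecting (n : nat) (F : {set {set 'I_n}}) : Prop :=
  forall A B : {set 'I_n}, A \in F -> B \in F -> A :&: B <> set0.

(* Main.v *)
Require Import Defs.
From mathcomp Require Import all_boot.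
From mathcomp Require Import zify.

Set Implicit Arguments.
Unset Strict Implicit.
Unset Printing Implicit Defensive.

(* If A and B are disjoint members, then no third member lies in A :|: B, and a
   (k-1)-set P disjoint from a member A extends by an element of A in at most
   one way, in which case P lies in no other member. Hence, for W a union of
   two or three pairwise disjoint members, the members meeting W in at most one
   point number at most C(n - |W|, k - 1): weigh each member disjoint from W by
   the degrees of its (k-1)-subsets; a member S of small weight is met by every
   member in 0 or at least 3 points, so few members meet any such S. Those
   meeting W in two points contribute at most 2k - 3 for each trace outside W,
   and those meeting it in three or more points are negligible. With |W| = 3k
   this is already below the bound.

   So suppose that no three members are pairwise disjoint, and let A, B be
   disjoint. Every member meets W = A :|: B; let x, in A say, be the most
   popular one-point trace on W. Compare the family with the star of all k-sets
   through x that miss B. Each member other than B that meets B, and does so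
   at least twice if it avoids x, excludes at least n - 2k + 1 star sets, and
   each star set is excluded at most C(2k, k) times. If T avoids x and meets B
   at most once, then for z in T :\: B and Q disjoint from T, a star set x, z, Q
   excludes all star sets x, Q, u with u outside T; so almost all star sets
   through z are absent, and these outnumber the sets T that fit into the union
   of all T :\: B. *)

Ltac arith :=
  repeat match goal with
  | H : is_true (leq _ _) |- _ => revert H
  | H : @eq nat _ _ |- _ => revert H
  end;
  repeat match goal with H : _ |- _ => clear H end;
  lia.

(** * Double counting and forbidden triples *)

Lemma double_count (I J : finType) (P : {set I}) (Q : {set J})
    (r : I -> J -> bool) (p q : nat) :
    (forall i, i \in P -> p <= #|[set j in Q | r i j]|) ->
    (forall j, j \in Q -> #|[set i in P | r i j]| <= q) ->
  #|P| * p <= #|Q| * q.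
Proof.
move=> leP leQ; rewrite -!sum_nat_const.
apply: (@leq_trans (\sum_(i in P) \sum_(j in Q | r i j) 1)).
  by apply: leq_sum => i /leP; rewrite -sum1dep_card big_mkcondr -big_mkcondr.
rewrite (exchange_big_dep (mem Q)) /=; last by move=> i j _ /andP[].
apply: leq_sum => j Qj; apply: leq_trans (leQ j Qj); rewrite -sum1dep_card.
by rewrite leq_eqVlt; apply/orP; left; apply/eqP; apply: eq_bigl => i; rewrite Qj.
Qed.

Lemma card_supersets (V : finType) (D Y : {set V}) (j : nat) :
  #|[set R : {set V} | [&& R \subset Y, #|R| == j & D \subset R]]|
    <= 'C(#|Y| - #|D|, j - #|D|).
Proof.
case: (boolP (D \subset Y)) => [DY|nDY]; last first.
  rewrite (_ : [set _ | _] = set0) ?cards0 //; apply/setP => R; rewrite !inE.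
  by apply: contraNF nDY => /and3P[RY _ DR]; apply: subset_trans DR RY.
rewrite -(cardsDS DY) -cards_draws.
rewrite -(@card_in_imset _ _ (fun R => R :\: D)).
  apply/subset_leq_card/subsetP => _ /imsetP[R + ->].
  rewrite !inE => /and3P[RY /eqP <- DR].
  by rewrite setSD //= cardsDS.
move=> R R'; rewrite !inE => /and3P[_ _ DR] /and3P[_ _ DR'] eqRR'.
by rewrite -(setID R D) -(setID R' D) eqRR' (setIidPr DR) (setIidPr DR').
Qed.

Definition uniform (V : finType) (k : nat) (F : {set {set V}}) : Prop :=
  forall A, A \in F -> #|A| = k.

(** [U] stands for the union and the last premise for the empty intersection, so that a use of the
    condition only has to exhibit a small set containing the three members. *)
Definition triple_free (V : finType) (s : nat) (F : {set {set V}}) : Prop :=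
  forall A B C U : {set V}, A \in F -> B \in F -> C \in F ->
    A != B -> A != C -> B != C ->
    A \subset U -> B \subset U -> C \subset U -> #|U| <= s ->
    (forall e, e \in A -> e \in B -> e \in C -> False) -> False.

Lemma card_setU_le (V : finType) (A B : {set V}) a b :
  #|A| <= a -> #|B| <= b -> #|A :|: B| <= a + b.
Proof.
by move=> Aa Bb; apply: leq_trans (leq_card_setU A B).1 _; apply: leq_add.
Qed.

Lemma card_setU1_le (V : finType) x (B : {set V}) b :
  #|B| <= b -> #|x |: B| <= b.+1.
Proof. by move=> Bb; rewrite cardsU1; arith. Qed.

Lemma neq_in (V : finType) (A B : {set V}) x : x \in A -> x \notin B -> A != B.
Proof. by move=> Ax; apply: contraNneq => <-. Qed.

Lemma disjoint_notin (V : finType) (A B : {set V}) x :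
  [disjoint A & B] -> x \in A -> x \notin B.
Proof. by move=> dAB Ax; rewrite (disjointFr dAB). Qed.

Section Families.

Variables (V : finType) (k : nat) (F : {set {set V}}).
Hypotheses (k3 : 3 <= k) (kF : uniform k F) (tF : triple_free (2 * k) F).

(** If [v] and [w] differ, the sets [A], [w |: P] and [v |: P] lie in [A :|: (v |: P)], of size at
    most 2k because [w] is already in [A]. A common point would be in [A], hence outside [P], hence
    equal to both [v] and [w]. *)
Lemma unique_extension (A P : {set V}) v w : A \in F -> w \in A -> [disjoint P & A] ->
  #|P| = k - 1 -> w |: P \in F -> v |: P \in F -> v = w.
Proof.
move=> FA Aw dPA cP FwP FvP; apply/eqP; apply: contraT => vw; exfalso.
have /card_gt0P[p Pp] : 0 < #|P| by arith.
have Ap := disjoint_notin dPA Pp.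
apply: (tF (U := A :|: (v |: P)) FA FwP FvP).
- by rewrite eq_sym; apply: (neq_in (x := p)) => //; rewrite !inE Pp orbT.
- by rewrite eq_sym; apply: (neq_in (x := p)) => //; rewrite !inE Pp orbT.
- apply: (neq_in (x := w)); rewrite !inE ?eqxx // negb_or eq_sym vw.
  by rewrite (disjointFl dPA).
- exact: subsetUl.
- apply/subsetP => e; rewrite !inE => /predU1P[->|->]; first by rewrite Aw.
  by rewrite !orbT.
- exact: subsetUr.
- by apply: leq_trans (card_setU_le (eq_leq (kF FA)) (eq_leq (kF FvP))) _; arith.
move=> e Ae; rewrite !inE (disjointFl dPA Ae) !orbF => /eqP ->.
by rewrite eq_sym (negPf vw).
Qed.

(** A third member inside the 2k points of [A :|: B] would complete a forbidden triple. Every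
    exclusion of a star set below rests on this. *)
Lemma disjoint_pair_alone (A B C : {set V}) : A \in F -> B \in F -> C \in F ->
  [disjoint A & B] -> C \subset A :|: B -> C = A \/ C = B.
Proof.
move=> FA FB FC dAB sC; case: (eqVneq C A) => [|nCA]; first by left.
case: (eqVneq C B) => [|nCB]; first by right.
exfalso; apply: (tF (U := A :|: B) FA FB FC); rewrite 1?eq_sym //.
- have /card_gt0P[p Ap] : 0 < #|A| by rewrite kF //; arith.
  by rewrite eq_sym; apply: neq_in Ap (disjoint_notin dAB Ap).
- exact: subsetUl.
- exact: subsetUr.
- by apply: leq_trans (card_setU_le (eq_leq (kF FA)) (eq_leq (kF FB))) _; arith.
by move=> e Ae Be; rewrite (disjointFr dAB Ae) in Be.
Qed.

End Families.

(** * Traces on a union of disjoint members *)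

Lemma subset_of_card (V : finType) (X : {set V}) j :
  j <= #|X| -> exists2 D : {set V}, D \subset X & #|D| = j.
Proof.
rewrite -bin_gt0 -cards_draws => /card_gt0P[D]; rewrite inE => /andP[sD /eqP].
by exists D.
Qed.

Lemma setDI_inj (V : finType) (W C C' : {set V}) :
  C :\: W = C' :\: W -> C :&: W = C' :&: W -> C = C'.
Proof. by move=> eD eI; rewrite -(setID C W) eI eD setID. Qed.

Section Traces.

Variables (V : finType) (k : nat) (F : {set {set V}}).
Hypotheses (k3 : 3 <= k) (kF : uniform k F) (tF : triple_free (2 * k) F).
Variables (K : {set {set V}}).
Hypotheses (sKF : K \subset F) (tK : trivIset K) (cK : #|K| <= 3).

Let W := cover K.

Let sAW A : A \in K -> A \subset W.
Proof. exact: (bigcup_sup A). Qed.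

(** The three members lie in [A :|: L :|: (C :\: W)], of size at most k + 2 + (k - 2) = 2k. *)
Lemma same_rest_absurd (A C C' L : {set V}) : A \in K -> C \in F -> C' \in F ->
  C != C' -> #|C :&: W| = 2 -> C :\: W = C' :\: W -> #|L| <= 2 ->
  C :&: W \subset A :|: L -> C' :&: W \subset A :|: L ->
  (forall e, e \in A -> e \in C -> e \in C' -> False) -> False.
Proof.
move=> KA FC FC' nCC' cCW eqD cL sC sC'.
have FA : A \in F := subsetP sKF A KA.
have cD : #|C :\: W| = k - 2 by rewrite cardsD cCW kF.
(* A point of the common rest, which exists since k >= 3, shows that [A] is neither [C] nor [C']. *)
have /card_gt0P[p pD] : 0 < #|C :\: W| by arith.
have nAp : p \notin A.
  by apply: contraL pD => /(subsetP (sAW KA)) Wp; rewrite inE Wp.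
have Cp : p \in C by case/setDP: pD.
have C'p : p \in C' by move: pD; rewrite eqD => /setDP[].
have sub X : X :\: W = C :\: W -> X :&: W \subset A :|: L ->
    X \subset A :|: L :|: (C :\: W).
  by move=> eX sX; rewrite -(setID X W) eX setSU.
apply: (tF (U := A :|: L :|: (C :\: W)) FA FC FC') => //.
- by rewrite eq_sym (neq_in Cp).
- by rewrite eq_sym (neq_in C'p).
- by rewrite -setUA subsetUl.
- exact: sub.
- exact: sub.
apply: leq_trans (card_setU_le (card_setU_le (eq_leq (kF FA)) cL) (eq_leq cD)) _.
by arith.
Qed.

Section Fibre.

Variable (P : {set V}).
Let D := [set C in F | (C :\: W == P) && (#|C :&: W| == 2)].

Let D_meet C C' : C \in D -> C' \in D -> C != C' ->
  exists2 w, w \in C :&: W & w \in C'.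
Proof.
rewrite !inE => /and3P[FC /eqP CP /eqP C2] /and3P[FC' /eqP C'P /eqP C'2] nCC'.
case: (boolP [disjoint C :&: W & C' :&: W]) => [dis|]; last first.
  by rewrite -setI_eq0 => /set0Pn[w /setIP[wC /setIP[wC' _]]]; exists w.
exfalso; pose X := (C :&: W) :|: (C' :&: W).
have X4 : #|X| = 4 by rewrite cardsU (disjoint_setI0 dis) cards0 C2 C'2.
have XW v : v \in X -> v \in W by rewrite !inE -andb_orl => /andP[].
(* Pigeonhole: two disjoint traces have four points in at most three blocks, so some block holds two
   of them; the other two form [L]. *)
have /dinjectivePn[v Xv [w]] : ~~ dinjectiveb (pblock K) (mem X).
  apply/negP => /dinjectiveP inj.
  have : #|pblock K @: X| <= 3.
    apply: leq_trans cK; apply/subset_leq_card/subsetP => _ /imsetP[v /XW Wv ->].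
    exact: pblock_mem.
  by rewrite card_in_imset // X4.
rewrite !inE => /andP[wv Xw] eqvw.
have Av : v \in pblock K v by rewrite mem_pblock XW.
have Aw : w \in pblock K v by rewrite eqvw mem_pblock XW // !inE.
have AW : pblock K v \in K by rewrite pblock_mem // XW.
have sX : X \subset pblock K v :|: (X :\: [set v; w]).
  apply/subsetP => e Xe; rewrite in_setU in_setD Xe andbT in_set2.
  by case: eqP => [->|_]; [rewrite Av | case: eqP => [->|_]; rewrite ?Aw ?orbT].
apply: (same_rest_absurd (L := X :\: [set v; w]) AW FC FC') => //.
- by rewrite CP C'P.
- have sv : [set v; w] \subset X.
    by apply/subsetP => e /set2P[] -> //; rewrite !inE.
  by rewrite cardsD (setIidPr sv) cards2 eq_sym wv X4.
- exact: subset_trans (subsetUl _ _) sX.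
- exact: subset_trans (subsetUr _ _) sX.
move=> e /(subsetP (sAW AW)) We eC eC'.
have : e \in C :&: W by rewrite inE eC.
by move/(disjoint_notin dis); rewrite inE eC' We.
Qed.

(** If [u] and [w] were in different blocks, take for [A] the block of [w] and for [L] the trace of
    [C'], which contains [u]. The only point of [C] in [A] is then [w], and [w] is not in [C']
    because the traces differ. *)
Let D_pure_aux C C' u w : C \in D -> C' \in D -> C != C' ->
  C :&: W = [set u; w] -> u \in C' -> pblock K u = pblock K w.
Proof.
move=> DC DC' nCC' Ce C'u; apply/eqP; apply: contraT => nuw; exfalso.
move: DC DC'; rewrite !inE => /and3P[FC /eqP CP /eqP C2].
move=> /and3P[FC' /eqP C'P C'2].
have [Wu Ww] : u \in W /\ w \in W.
  by split; apply: (subsetP (subsetIr C W)); rewrite Ce !inE eqxx ?orbT.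
have uw : u != w by apply: contraNneq nuw => ->.
have nC'w : w \notin C'.
  apply: contra nCC' => C'w; apply/eqP/(@setDI_inj _ W); first by rewrite CP C'P.
  apply/eqP; rewrite eqEcard C2 (eqP C'2) leqnn andbT Ce.
  by apply/subsetP => e /set2P[] ->; rewrite inE ?C'u ?C'w ?Wu ?Ww.
have AW : pblock K w \in K by rewrite pblock_mem.
apply: (same_rest_absurd (L := C' :&: W) AW FC FC') => //.
- by rewrite CP C'P.
- by rewrite (eqP C'2).
- apply/subsetP => e; rewrite Ce => /set2P[]->; rewrite !inE ?C'u ?Wu ?orbT //.
  by rewrite mem_pblock Ww.
- exact: subsetUr.
move=> e Ae Ce0 C'e.
have : e \in C :&: W by rewrite inE Ce0 (subsetP (sAW AW)).
rewrite Ce => /set2P[] Ee; last by rewrite Ee (negPf nC'w) in C'e.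
by move: Ae nuw; rewrite Ee => /(same_pblock tK) ->; rewrite eqxx.
Qed.

Let D_pure C C' u w : C \in D -> C' \in D -> C != C' ->
  u \in C :&: W -> w \in C :&: W -> pblock K u = pblock K w.
Proof.
move=> DC DC' nCC'.
have [e Ce C'e] := D_meet DC DC' nCC'.
have /cards2P[x [y [xy CE]]] : #|C :&: W| == 2 by move: DC; rewrite !inE => /and3P[].
have pxy : pblock K x = pblock K y.
  move: Ce; rewrite CE => /set2P[] Ee; first by apply: (D_pure_aux DC DC' nCC' CE); rewrite -Ee.
  by apply/esym/(D_pure_aux DC DC' nCC'); [rewrite CE setUC | rewrite -Ee].
by rewrite CE => /set2P[]-> /set2P[]->.
Qed.

(** Once the fibre has two members, all traces are pairs inside a single block [A] that meet the
    fixed pair [C0 :&: W]. There are C(k, 2) - C(k - 2, 2) = 2k - 3 such pairs. *)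
Lemma pair_trace_fibre : #|D| <= 2 * k - 3.
Proof.
case: (leqP #|D| 1) => [|D2]; first by arith.
have /card_gt0P[C0 DC0] : 0 < #|D| by arith.
have /cards2P[p [q [pq CE]]] : #|C0 :&: W| == 2.
  by move: DC0; rewrite !inE => /and3P[].
have Wp : p \in W by apply: (subsetP (subsetIr C0 W)); rewrite CE !inE eqxx.
set A := pblock K p.
have KA : A \in K by rewrite pblock_mem.
have FA : A \in F := subsetP sKF A KA.
have [C1 DC1 nC10] : exists2 C, C \in D & C != C0.
  have /card_gt0P[C] : 0 < #|D :\ C0| by move: D2; rewrite (cardsD1 C0) DC0; arith.
  by rewrite in_setD1 => /andP[]; exists C.
have inA C : C \in D -> (C :&: W \subset A) && ~~ [disjoint C :&: W & C0 :&: W].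
  move=> DC.
  have [u Cu C0u] : exists2 u, u \in C :&: W & u \in C0 :&: W.
    case: (eqVneq C C0) => [->|n]; first by exists p; rewrite CE !inE eqxx.
    have [u Cu C0u] := D_meet DC DC0 n.
    by exists u => //; rewrite inE C0u (subsetP (subsetIr C W)).
  apply/andP; split; last by apply: contraL Cu => d; rewrite (disjointFl d).
  apply/subsetP => v Cv.
  have eqpu : pblock K u = A.
    apply: (D_pure DC0 DC1) => //; first by rewrite eq_sym.
    by rewrite CE !inE eqxx.
  have Wv := subsetP (subsetIr C W) v Cv.
  rewrite -eqpu; case: (eqVneq C C0) => [e|n].
    rewrite (D_pure DC0 DC1 (u := u) (w := v)) ?mem_pblock // -?e //.
    by rewrite e eq_sym.
  by rewrite (D_pure DC DC0 n Cu Cv) mem_pblock.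
rewrite -(@card_in_imset _ _ (fun C => C :&: W)); last first.
  move=> C C'; rewrite !inE => /and3P[_ /eqP CP _] /and3P[_ /eqP C'P _].
  by apply: setDI_inj; rewrite CP C'P.
pose dr (X : {set V}) := [set J : {set V} | J \subset X & #|J| == 2].
apply: (@leq_trans #|dr A :\: dr (A :\: (C0 :&: W))|).
  apply/subset_leq_card/subsetP => _ /imsetP[C DC ->].
  have /andP[CA nd] := inA C DC.
  have /and3P[_ _ C2] : [&& C \in F, C :\: W == P & #|C :&: W| == 2].
    by rewrite !inE in DC.
  rewrite !inE CA C2 !andbT; apply: contra nd; rewrite subsetD => /andP[_ //].
have sd : dr (A :\: (C0 :&: W)) \subset dr A.
  apply/subsetP => J; rewrite !inE => /andP[J1 ->]; rewrite andbT.
  exact: subset_trans J1 (subsetDl _ _).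
have c0 : #|A :&: (C0 :&: W)| = 2.
  have /andP[s _] := inA C0 DC0.
  by rewrite (setIidPr s) CE cards2 pq.
rewrite cardsDS // !cards_draws cardsD c0 kF //.
case: k k3 => [|[|[|m]]] // _; rewrite (_ : m.+3 - 2 = m.+1); last by arith.
by rewrite (binS m.+2) (binS m.+1) !bin1; arith.
Qed.

End Fibre.

Lemma card_trace2 :
  #|[set C in F | #|C :&: W| == 2]| <= 'C(#|~: W|, k - 2) * (2 * k - 3).
Proof.
rewrite -cards_draws -[X in X <= _]muln1.
apply: (double_count (r := fun C Q => C :\: W == Q)) => [C|Q _].
  rewrite inE => /andP[FC /eqP C2]; apply/card_gt0P; exists (C :\: W).
  by rewrite !inE eqxx cardsD C2 kF // eqxx !andbT setDE subsetIr.
apply: leq_trans (pair_trace_fibre Q); apply/subset_leq_card/subsetP => C.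
by rewrite !inE => /andP[/andP[-> ->] ->].
Qed.

End Traces.

Lemma card_trace3 (V : finType) (k : nat) (F : {set {set V}}) (W : {set V}) :
    uniform k F ->
  #|[set C in F | 3 <= #|C :&: W|]| <= 'C(#|W|, 3) * 'C(#|V| - 3, k - 3).
Proof.
move=> kF; rewrite -cards_draws -[X in X <= _]muln1.
apply: (double_count (r := fun C D : {set V} => D \subset C)) => [C|D].
  rewrite inE => /andP[FC /subset_of_card[D sD D3]].
  apply/card_gt0P; exists D; move: sD; rewrite subsetI => /andP[DC DW].
  by rewrite !inE DC DW D3 eqxx.
rewrite inE => /andP[_ /eqP D3].
apply: leq_trans (_ : _ <= 'C(#|[set: V]| - #|D|, k - #|D|)) _; last first.
  by rewrite D3 cardsT.
apply: leq_trans (card_supersets D setT k); apply/subset_leq_card/subsetP => C.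
by rewrite !inE subsetT => /andP[/andP[/kF-> _] ->]; rewrite eqxx.
Qed.

Lemma card_by_trace (V : finType) (k : nat) (F K : {set {set V}}) :
    3 <= k -> uniform k F -> triple_free (2 * k) F ->
    K \subset F -> trivIset K -> #|K| <= 3 ->
  #|F| <= #|[set C in F | #|C :&: cover K| <= 1]|
          + 'C(#|~: cover K|, k - 2) * (2 * k - 3)
          + 'C(#|cover K|, 3) * 'C(#|V| - 3, k - 3).
Proof.
move=> k3 kF tF sK tK cK; set W := cover K.
apply: leq_trans (card_setU_le (card_setU_le (leqnn _)
  (card_trace2 k3 kF tF sK tK cK)) (card_trace3 W kF)).
apply/subset_leq_card/subsetP => C FC; rewrite !inE FC /=.
by case: (#|C :&: W|) => [|[|[|m]]].
Qed.

(** * Members with at most one point in a union of disjoint members *)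

Section Shadow.

Variables (V : finType) (k : nat) (F : {set {set V}}).
Hypotheses (k3 : 3 <= k) (kF : uniform k F) (tF : triple_free (2 * k) F).
Variables (K : {set {set V}}).
Hypothesis (sKF : K \subset F).

Let W := cover K.
Let F0 := [set C in F | C :&: W == set0].
Let d (R : {set V}) := #|[set C in F0 | R \subset C]|.
(* A (k-1)-set of degree [m] gives [c m] to each member above it, hence at most
   2 in all, so that members of weight at least 2 are no more than shadow sets. *)
Let c (m : nat) := if m == 1 then 2 else (m == 2 : nat).
Let wt (S : {set V}) := \sum_(y in S) c (d (S :\ y)).
Let bad := [set S in F0 | wt S < 2].
Let Z := cover bad.

Let F0F C : C \in F0 -> C \in F.
Proof. by rewrite inE => /andP[]. Qed.

Let other_ext S S' y : S \in F -> S' \in F -> y \in S -> S :\ y \subset S' ->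
  S' != S -> y \notin S' /\ #|S' :\: S| = 1.
Proof.
move=> FS FS' Sy sS nS.
have yS' : y \notin S'.
  apply: contra nS => S'y; rewrite eq_sym eqEcard !kF // leqnn andbT.
  by rewrite -(setD1K Sy) subUset sub1set S'y.
split=> //; have eI : S' :&: S = S :\ y.
  apply/eqP; rewrite eqEsubset subsetI sS subD1set !andbT.
  apply/subsetP => e /setIP[S'e Se]; rewrite !inE Se andbT.
  by apply: contraNneq yS' => <-.
have := cardsD1 y S; rewrite Sy -eI cardsD (kF FS) (kF FS').
by arith.
Qed.

Let other_ext_ex S y (E : {set {set V}}) : #|E| < d (S :\ y) ->
  exists S', [/\ S' \in F, S :\ y \subset S' & S' \notin E].
Proof.
move=> ltE; have /subsetPn[S'] : ~~ ([set C in F0 | S :\ y \subset C] \subset E).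
  by apply: contraL ltE => /subset_leq_card; rewrite -leqNgt.
by rewrite inE => /andP[/F0F FS' sS'] nE; exists S'.
Qed.

Let c_ge1 m : 0 < m -> c m <= 1 -> 2 <= m.
Proof. by rewrite /c; case: m => [|[|[|m]]]. Qed.

Let d_gt0 S y : S \in F0 -> 0 < d (S :\ y).
Proof.
by move=> FS; apply/card_gt0P; exists S; rewrite inE FS subD1set.
Qed.

(** A degree equal to 1 would contribute weight 2 by itself. *)
Let bad_d2 S y : S \in bad -> y \in S -> 2 <= d (S :\ y).
Proof.
rewrite inE => /andP[FS wS] Sy; apply: c_ge1; first exact: d_gt0.
by move: wS; rewrite /wt (bigD1 y) //=; arith.
Qed.

(** Two degrees equal to 2 would contribute 1 each. *)
Let bad_d3 S p q : S \in bad -> p \in S -> q \in S -> p != q ->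
  3 <= d (S :\ p) \/ 3 <= d (S :\ q).
Proof.
move=> bS Sp Sq pq.
have d2p := bad_d2 bS Sp; have d2q := bad_d2 bS Sq.
case: (ltnP 2 (d (S :\ p))) => lep; first by left.
case: (ltnP 2 (d (S :\ q))) => leq; first by right.
move: bS; rewrite inE => /andP[_]; rewrite /wt (bigD1 p) // (bigD1 q) /=.
  have -> : d (S :\ p) = 2 by arith.
  by have -> : d (S :\ q) = 2 by arith.
by rewrite Sq eq_sym.
Qed.

(* C meets S only in p and q, while the members Sp' and Sq' replace p, resp. q, in
   S by a new point; as S :\ p has three extensions, the two new points can be
   chosen distinct, so that C, Sp' and Sq' have no common point. *)
Let bad_pair S C p q : S \in bad -> C \in F -> p \in S -> q \in S -> p != q ->
  C :&: S = [set p; q] -> 3 <= d (S :\ p) -> False.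
Proof.
move=> bS FC Sp Sq pq eCS d3.
have FS : S \in F by move: bS; rewrite inE => /andP[/F0F].
have d2 := bad_d2 bS Sq.
have [Cp Cq] : p \in C /\ q \in C.
  by split; apply: (subsetP (subsetIl C S)); rewrite eCS !inE eqxx ?orbT.
have [Sq' [FSq sSq]] : exists S', [/\ S' \in F, S :\ q \subset S' & S' \notin [set S]].
  by apply: other_ext_ex; rewrite cards1.
rewrite inE => nSq.
have [qSq /eqP/cards1P[z ez]] := other_ext FS FSq Sq sSq nSq.
have [Sp' [FSp sSp]] := other_ext_ex (E := [set S; z |: (S :\ p)])
  (leq_ltn_trans (card_setU_le (eq_leq (cards1 _)) (eq_leq (cards1 _))) d3).
rewrite !inE negb_or => /andP[nSp nz].
have [pSp cSp] := other_ext FS FSp Sp sSp nSp.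
apply: (tF (U := S :|: (Sp' :\: S) :|: (Sq' :\: S) :|: (C :\: S)) FSp FSq FC).
- by apply: neq_in qSq; apply: (subsetP sSp); rewrite !inE eq_sym pq.
- by rewrite eq_sym; apply: neq_in pSp.
- by rewrite eq_sym; apply: neq_in qSq.
- by apply/subsetP => e; rewrite !inE => ->; case: (e \in S).
- by apply/subsetP => e; rewrite !inE => ->; case: (e \in S); rewrite ?orbT.
- by apply/subsetP => e; rewrite !inE => ->; case: (e \in S); rewrite ?orbT.
- have cCS : #|C :\: S| <= k - 2 by rewrite cardsD eCS cards2 pq kF.
  have cz : #|Sq' :\: S| <= 1 by rewrite ez cards1.
  apply: leq_trans (card_setU_le (card_setU_le (card_setU_le (eq_leq (kF FS))
    (eq_leq cSp)) cz) cCS) _.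
  by arith.
move=> e eSp eSq eC; case: (boolP (e \in S)) => eS.
  have : e \in C :&: S by rewrite inE eC.
  by rewrite eCS => /set2P[] E; [move: pSp | move: qSq]; rewrite -E ?eSp ?eSq.
have : e \in Sq' :\: S by rewrite inE eS.
rewrite ez inE => /eqP E; move: nz; rewrite eq_sym eqEcard negb_and.
rewrite subUset sub1set -E eSp sSp /= cardsU1 !inE (negPf eS) andbF.
by have := cardsD1 p S; rewrite Sp (kF FS) (kF FSp); arith.
Qed.

(** Two common points are excluded by [bad_pair], with [p] and [q] named so that [S :\ p] has degree
    at least 3. If [v] is the only common point, replace it in [S] to get a member [S']: then [S],
    [S'] and [C] lie in k + 1 + (k - 1) points and share none, as [v] is not in [S']. *)
Let bad_meet S C v : S \in bad -> C \in F -> v \in S -> v \in C ->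
  3 <= #|C :&: S|.
Proof.
move=> bS FC Sv Cv; rewrite leqNgt; apply/negP.
have FS : S \in F by move: bS; rewrite inE => /andP[/F0F].
rewrite ltnS leq_eqVlt => /orP[/cards2P[p [q [pq e]]]|].
  have [Sp Sq] : p \in S /\ q \in S.
    by split; apply: (subsetP (subsetIr C S)); rewrite e !inE eqxx ?orbT.
  have [] := bad_d3 bS Sp Sq pq; first exact: bad_pair e.
  by apply: (bad_pair bS FC Sq Sp _ (etrans e (setUC _ _))); rewrite eq_sym.
rewrite ltnS => le1.
have eCS : C :&: S = [set v].
  by apply/eqP; rewrite eq_sym eqEcard cards1 le1 sub1set inE Cv Sv.
have [S' [FS' sS]] : exists S', [/\ S' \in F, S :\ v \subset S' & S' \notin [set S]].
  by apply: other_ext_ex; rewrite cards1 bad_d2.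
rewrite inE => nS; have [vS' cS'] := other_ext FS FS' Sv sS nS.
apply: (tF (U := S :|: (S' :\: S) :|: (C :\: S)) FS FS' FC).
- by rewrite eq_sym.
- apply: contraTneq le1 => <-; rewrite setIid kF //.
  by arith.
- by rewrite eq_sym; apply: neq_in vS'.
- by rewrite -setUA subsetUl.
- by apply/subsetP => e; rewrite !inE => ->; case: (e \in S); rewrite ?orbT.
- by apply/subsetP => e; rewrite !inE => ->; case: (e \in S); rewrite ?orbT.
- have cCS : #|C :\: S| <= k - 1 by rewrite cardsD eCS cards1 kF.
  apply: leq_trans (card_setU_le (card_setU_le (eq_leq (kF FS)) (eq_leq cS')) cCS) _.
  by arith.
move=> e eS eS' eC; have : e \in C :&: S by rewrite inE eC.
by rewrite eCS inE => /eqP E; move: vS'; rewrite -E eS'.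
Qed.

(** For [v] in [Z], fix a bad [S] through [v]: a member through [v] contains two further points of
    [S], which leaves C(k - 1, 2) choices of the pair and k - 3 free points. *)
Let card_meeting :
  #|[set C in F | ~~ [disjoint C & Z]]|
    <= #|Z| * ('C(k - 1, 2) * 'C(#|V| - 3, k - 3)).
Proof.
rewrite -[X in X <= _]muln1.
apply: (double_count (r := fun (C : {set V}) v => v \in C)) => [C|v].
  rewrite inE -setI_eq0 => /andP[_ /set0Pn[v /setIP[Cv Zv]]].
  by apply/card_gt0P; exists v; rewrite inE Zv.
move=> /bigcupP[S bS Sv].
have FS : S \in F by move: bS; rewrite inE => /andP[/F0F].
have <- : #|S :\ v| = k - 1 by have := cardsD1 v S; rewrite Sv kF //; arith.
rewrite -cards_draws -[X in X <= _]muln1.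
apply: (double_count (r := fun C D : {set V} => v |: D \subset C)) => [C|D].
  rewrite !inE => /andP[/andP[FC _] Cv].
  have leC := bad_meet bS FC Sv Cv.
  have [D sD D2] : exists2 D : {set V}, D \subset (C :&: S) :\ v & #|D| = 2.
    by apply: subset_of_card; move: leC; rewrite (cardsD1 v) inE Cv Sv.
  apply/card_gt0P; exists D; rewrite !inE D2 eqxx andbT.
  rewrite (subset_trans sD) ?setSD ?subsetIr //=.
  rewrite subUset sub1set Cv (subset_trans sD) //.
  by rewrite (subset_trans (subD1set _ _)) ?subsetIl.
rewrite inE => /andP[sD /eqP D2].
have cD : #|v |: D| = 3.
  rewrite cardsU1 D2; case: (boolP (v \in D)) => // /(subsetP sD).
  by rewrite !inE eqxx.
apply: leq_trans (_ : _ <= 'C(#|[set: V]| - #|v |: D|, k - #|v |: D|)) _.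
  apply: leq_trans (card_supersets (v |: D) setT k).
  apply/subset_leq_card/subsetP => C.
  by rewrite !inE subsetT => /andP[/andP[/andP[/kF-> _] _] ->]; rewrite eqxx.
by rewrite cD cardsT.
Qed.

Let R0 := [set R : {set V} |
  [&& R \subset ~: W :\: Z, #|R| == k - 1 & 0 < d R]].

(** Discharging, with both sides doubled: a member of [F0] disjoint from [Z] is not bad, so it
    receives weight at least 2 from its (k-1)-subsets, all of them in [R0], while a set of degree m
    gives away at most m * c m <= 2. *)
Let card_avoid0 : #|[set C in F0 | [disjoint C & Z]]| <= #|R0|.
Proof.
rewrite -(leq_pmul2r (isT : 0 < 2)) -!sum_nat_const.
apply: (@leq_trans (\sum_(S in [set C in F0 | [disjoint C & Z]])
                     \sum_(R in R0 | R \subset S) c (d R))).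
  apply: leq_sum => S; rewrite inE => /andP[F0S dS].
  have FS := F0F F0S.
  apply: (@leq_trans (wt S)).
    rewrite leqNgt; apply/negP => wS.
    have bS : S \in bad by rewrite inE F0S.
    have /card_gt0P[v Sv] : 0 < #|S| by rewrite kF //; arith.
    have /negP[] := disjoint_notin dS Sv.
    by apply/bigcupP; exists S.
  rewrite /wt -(big_imset (fun R => c (d R)) (h := fun y => S :\ y)) /=; last first.
    move=> y z Sy Sz /setP /(_ y); rewrite !inE eqxx Sy /= andbT.
    by move/esym/negbFE/eqP.
  rewrite [X in _ <= X](bigID (mem [set S :\ y | y in S])) /=.
  apply: leq_trans (leq_addr _ _); apply: eq_leq; apply: eq_bigl => R.
  case: (boolP (R \in [set S :\ y | y in S])); rewrite ?andbF // andbT.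
  case/imsetP => y Sy ->; rewrite inE subD1set d_gt0 // !andbT.
  have -> : #|S :\ y| == k - 1 by have := cardsD1 y S; rewrite Sy kF //; arith.
  rewrite andbT; apply/esym/subsetP => e; rewrite !inE => /andP[_ Se].
  rewrite (disjoint_notin dS Se) /=; move: F0S; rewrite inE => /andP[_ /eqP/setP/(_ e)].
  by rewrite !inE Se /= => ->.
rewrite (exchange_big_dep (mem R0)) /=; last by move=> S R _ /andP[].
apply: leq_sum => R RR0.
rewrite (eq_bigl (fun S => S \in [set C in F0 | [disjoint C & Z] & R \subset C])).
  rewrite sum_nat_const; apply: (@leq_trans (d R * c (d R))).
    rewrite leq_mul2r; apply/orP; right.
    apply/subset_leq_card/subsetP => C; rewrite !inE.
    by case/and3P => -> _ ->.
  by rewrite /c; case: (d R) => [|[|[|m]]] //=; rewrite muln0.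
by move=> S; rewrite RR0 !inE -andbA.
Qed.

Let trace1 C : C \in F -> #|C :&: W| = 1 ->
  exists w, [/\ w \in W, C = w |: (C :\: W) & #|C :\: W| = k - 1].
Proof.
move=> FC /[dup] C1 /eqP/cards1P[w ew]; exists w; split.
- by apply: (subsetP (subsetIr C W)); rewrite ew inE.
- by rewrite -{1}(setID C W) ew.
by rewrite cardsD C1 kF.
Qed.

(** This is [unique_extension] for the block containing the one-point trace, since that block is
    disjoint from the rest [C :\: W]. *)
Let trace1_unique C v : C \in F -> #|C :&: W| = 1 ->
  v |: (C :\: W) \in F -> C = v |: (C :\: W).
Proof.
move=> FC C1 Fv; have [w [Ww eC cC]] := trace1 FC C1.
have KA : pblock K w \in K by rewrite pblock_mem.
rewrite {1}eC; congr (_ |: _); apply/esym.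
apply: (unique_extension k3 kF tF (subsetP sKF _ KA) (w := w)) cC _ Fv => //.
- by rewrite mem_pblock.
- rewrite -setI_eq0; apply/eqP/setP => e; rewrite !inE.
  case: (boolP (e \in pblock K w)); rewrite ?andbF // => Ae.
  by rewrite (_ : e \in W) //; apply/bigcupP; exists (pblock K w).
by rewrite -eC.
Qed.

Lemma card_trace1_sub (X : {set V}) (E : {set {set V}}) :
  E \subset F -> (forall C, C \in E -> #|C :&: W| = 1 /\ C :\: W \subset X) ->
  #|E| <= 'C(#|X|, k - 1).
Proof.
move=> sE PE; rewrite -cards_draws -(@card_in_imset _ _ (fun C => C :\: W) (mem E)).
  apply/subset_leq_card/subsetP => _ /imsetP[C EC ->].
  have [C1 CX] := PE C EC; have FC := subsetP sE C EC.
  by have [w [_ _ cC]] := trace1 FC C1; rewrite inE CX cC eqxx.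
move=> C C' EC EC' eD; have [C1 _] := PE C EC; have [C'1 _] := PE C' EC'.
have FC := subsetP sE C EC; have FC' := subsetP sE C' EC'.
have [w [_ eC' _]] := trace1 FC' C'1.
by rewrite eC' -eD; apply: trace1_unique; rewrite // eD -eC'.
Qed.

(** The rests [C :\: W] are distinct by [trace1_unique], and none is in [R0]: a member of [F0] above
    such a rest would extend it by one point, hence equal [C], although it misses [W]. *)
Let card_avoid1 :
  #|[set C in F | (#|C :&: W| == 1) && [disjoint C & Z]]|
    <= 'C(#|~: W :\: Z|, k - 1) - #|R0|.
Proof.
set E := [set C in F | _].
rewrite -cards_draws; set dr := [set R | _].
have sR0 : R0 \subset dr.
  by apply/subsetP => R; rewrite !inE => /and3P[-> ->].
rewrite -(cardsDS sR0) -(@card_in_imset _ _ (fun C => C :\: W) (mem E)).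
  apply/subset_leq_card/subsetP => _ /imsetP[C + ->].
  rewrite inE => /and3P[FC /eqP C1 dC].
  have [w [Ww eC cC]] := trace1 FC C1.
  rewrite !inE cC eqxx andbT !andTb.
  have -> : C :\: W \subset ~: W :\: Z.
    apply/subsetP => e; rewrite !inE => /andP[-> Ce]; rewrite andbT.
    exact: disjoint_notin dC Ce.
  rewrite /= andbT -leqNgt leqn0 cards_eq0; apply/eqP/setP => S.
  rewrite !inE; apply/negP => /andP[/andP[FS /eqP S0] sS].
  have cSD : #|S :\: (C :\: W)| = 1.
    by rewrite cardsD (setIidPr sS) cC kF //; arith.
  have /cards1P[v ev] : #|S :\: (C :\: W)| == 1 by rewrite cSD.
  have eS : S = v |: (C :\: W).
    by rewrite -(setID S (C :\: W)) (setIidPr sS) ev setUC.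
  have eSC : C = S by rewrite eS; apply: trace1_unique; rewrite // -eS.
  by move: C1; rewrite eSC S0 cards0.
move=> C C'; rewrite !inE => /and3P[FC /eqP C1 _] /and3P[FC' /eqP C'1 _] eD.
have [w [_ eC' _]] := trace1 FC' C'1.
by rewrite eC' -eD; apply: trace1_unique; rewrite // eD -eC'.
Qed.

(** The size of [R0] cancels between [card_avoid0] and [card_avoid1]; the last summand pays for the
    members that meet [Z], with z = [#|Z|]. *)
Lemma card_trace01 : exists2 z, z <= #|~: W| &
  #|[set C in F | #|C :&: W| <= 1]|
    <= 'C(#|~: W| - z, k - 1) + z * ('C(k - 1, 2) * 'C(#|V| - 3, k - 3)).
Proof.
have ZW : Z \subset ~: W.
  apply/subsetP => e /bigcupP[S]; rewrite !inE => /andP[/andP[_ /eqP S0] _] Se.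
  by move/setP/(_ e): S0; rewrite !inE Se /= => ->.
exists #|Z|; first exact: subset_leq_card.
set E0 := [set C in F0 | [disjoint C & Z]].
set E1 := [set C in F | (#|C :&: W| == 1) && [disjoint C & Z]].
have := card_setU_le (card_setU_le card_avoid0 card_avoid1) card_meeting.
rewrite subnKC ?cardsDS //; last first.
  rewrite -cardsDS // -cards_draws; apply/subset_leq_card/subsetP => R.
  by rewrite !inE => /and3P[-> ->].
apply: leq_trans; apply/subset_leq_card/subsetP => C.
rewrite !inE => /andP[FC]; rewrite FC /= leq_eqVlt ltnS leqn0 cards_eq0.
by case: [disjoint C & Z]; rewrite ?orbT //= !andbT => /orP[->|->]; rewrite ?orbT.
Qed.

End Shadow.

(** * Comparison with a star *)

Lemma extend_to_card (V : finType) (D Y : {set V}) j :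
  D \subset Y -> #|D| <= j -> j <= #|Y| ->
  exists R : {set V}, [/\ D \subset R, R \subset Y & #|R| = j].
Proof.
move=> sD cD cY; have [E sE cE] : exists2 E : {set V}, E \subset Y :\: D & #|E| = j - #|D|.
  by apply: subset_of_card; rewrite cardsDS //; arith.
exists (D :|: E); split; first exact: subsetUl.
  by rewrite subUset sD (subset_trans sE) ?subsetDl.
have dDE : D :&: E = set0.
  apply/setP => e; rewrite !inE; apply/negP => /andP[De /(subsetP sE)].
  by rewrite inE De.
by rewrite cardsU dDE cards0 cE; arith.
Qed.

Lemma card_add1 (V : finType) (Q X : {set V}) (E : {set {set V}}) :
  [disjoint Q & X] -> (forall u, u \in X -> u |: Q \in E) -> #|X| <= #|E|.
Proof.
move=> dQX XE; rewrite -(@card_in_imset _ _ (fun u => u |: Q) (mem X)).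
  by apply/subset_leq_card/subsetP => _ /imsetP[u Xu ->]; apply: XE.
move=> u v Xu Xv /setP/(_ u); rewrite !inE eqxx /= (disjointFl dQX Xu) orbF.
by move/esym/eqP.
Qed.

Lemma setU1_subset (V : finType) (Q R : {set V}) :
  Q \subset R -> #|R| = #|Q| + 1 -> exists2 u, u \notin Q & R = u |: Q.
Proof.
move=> sQ cR; have /eqP/cards1P[u eu] : #|R :\: Q| = 1 by rewrite cardsDS //; arith.
exists u; first by have := set11 u; rewrite -eu inE => /andP[].
by rewrite -(setID R Q) (setIidPr sQ) eu setUC.
Qed.

Section Star.

Variables (V : finType) (k : nat) (F : {set {set V}}).
Hypotheses (k3 : 3 <= k) (kF : uniform k F) (tF : triple_free (2 * k) F).
Variables (x : V) (B : {set V}).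
Hypotheses (FB : B \in F) (xB : x \notin B).

Let Y := ~: (x |: B).

(** The star of the k-sets through [x] that miss [B] is encoded by removing [x]: its elements are
    the (k-1)-subsets of [Y], and C(n - k - 1, k - 1) of them exist, the main term of the bound. *)
Definition star_present := [set R : {set V} | [&& R \subset Y, #|R| == k - 1 & x |: R \in F]].
Definition star_lost := [set R : {set V} | [&& R \subset Y, #|R| == k - 1 & x |: R \notin F]].
Definition off_star := [set T in F | (x \notin T) && (#|T :&: B| <= 1)].
Definition off_star_support := \bigcup_(T in off_star) (T :\: B).
(** In either case at most k - 2 points of [T] lie outside [x |: B]. *)
Definition blocked := [set T in F | (T != B) &&
  (if x \in T then ~~ [disjoint T & B] else 2 <= #|T :&: B|)].

Let P := star_present.
Let L := star_lost.
Let E := off_star.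
Let Z := off_star_support.

Lemma card_outside : #|Y| = #|V| - k - 1.
Proof. by have := cardsC (x |: B); rewrite cardsU1 xB kF // -/Y; arith. Qed.

Lemma card_present_lost : #|P| + #|L| = 'C(#|Y|, k - 1).
Proof.
rewrite -cards_draws -cardsUI (_ : P :&: L = set0) ?cards0 ?addn0.
  apply: eq_card => R; rewrite !inE.
  by case: (R \subset Y); case: (#|R| == _); case: (_ \in F).
by apply/setP => R; rewrite !inE; case: (_ \in F); rewrite ?andbF.
Qed.

Let xY : x \notin Y. Proof. by rewrite !inE eqxx. Qed.
Let YB : [disjoint Y & B].
Proof.
rewrite -setI_eq0; apply/eqP/setP => e; rewrite !inE.
by case: (e \in B); rewrite ?andbF ?orbT.
Qed.

Let star_disjoint (R : {set V}) : R \subset Y -> [disjoint x |: R & B].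
Proof.
move=> sR; rewrite -setI_eq0; apply/eqP/setP => e; rewrite !inE.
case: eqP => [->|_] /=; first by rewrite (negPf xB).
by apply/negP => /andP[/(subsetP sR)/(disjoint_notin YB)/negP].
Qed.

Lemma family_cover : #|F| <= 1 + #|P| + #|blocked| + #|E|.
Proof.
apply: leq_trans (_ : _ <= #|[set B] :|: [set x |: R | R in P] :|: blocked :|: E|) _.
  apply/subset_leq_card/subsetP => T FT; rewrite !inE FT /=.
  case: (eqVneq T B) => //= nTB; case: (boolP (x \in T)) => /= xT; last first.
    by case: ltnP; rewrite ?orbT.
  case: (boolP [disjoint T & B]) => dTB; rewrite ?orbT //= !orbF.
  apply/imsetP; exists (T :\ x); last by rewrite setD1K.
  rewrite !inE setD1K // FT andbT; apply/andP; split.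
    apply/subsetP => e; rewrite !inE => /andP[/negPf-> Te] /=.
    exact: disjoint_notin dTB Te.
  by have := cardsD1 x T; rewrite xT kF //; arith.
do 2![apply: card_setU_le => //]; apply: card_setU_le; first by rewrite cards1.
exact: leq_imset_card.
Qed.

(** Enlarge the part of [T] in [Y] to a (k-2)-set [R0]. For every further [u] in [Y] the star set x,
    u, R0 is disjoint from [B] and covers [T] together with [B], so it is lost by
    [disjoint_pair_alone]. Conversely, the sets [T] charged to a lost [R] are k-subsets of the at
    most 2k points of [(x |: R) :|: B]. *)
Lemma card_blocked : k - 2 <= #|Y| ->
  #|blocked| * (#|Y| - (k - 2)) <= #|L| * 'C(2 * k, k).
Proof.
move=> leY; apply: (double_count
  (r := fun T R : {set V} => (T :\: B) :\ x \subset R)) => [T|R].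
  rewrite inE => /and3P[FT nTB cT].
  have sTY : (T :\: B) :\ x \subset Y.
    by apply/subsetP => e; rewrite !inE negb_or => /and3P[-> ->].
  have cTk : #|(T :\: B) :\ x| <= k - 2.
    have := cardsD1 x (T :\: B); rewrite cardsD kF // inE xB.
    case: (x \in T) cT => /= [|?]; last by arith.
    by rewrite -setI_eq0 -card_gt0; arith.
  have [R0 [sTR sRY cR]] := extend_to_card sTY cTk leY.
  have sub : #|Y :\: R0| <= #|[set R in L | (T :\: B) :\ x \subset R]|.
    apply: (@card_add1 _ R0) => [|u].
      rewrite -setI_eq0; apply/eqP/setP => e; rewrite !inE.
      by case: (e \in R0).
    move=> /setDP[Yu nRu]; rewrite !inE (subset_trans sTR) ?subsetUr // andbT.
    have sY : u |: R0 \subset Y by rewrite subUset sub1set Yu.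
    rewrite sY cardsU1 nRu cR (_ : 1 + (k - 2) == k - 1) /=; last by arith.
    apply/negP => FS; have dS := star_disjoint sY.
    have dT : ~~ [disjoint T & B].
      by case: (x \in T) cT => //; rewrite -setI_eq0 -card_gt0; arith.
    have sT : T \subset (x |: (u |: R0)) :|: B.
      apply/subsetP => e Te; rewrite !inE; case: eqP => //= nex.
      case: (boolP (e \in B)); rewrite ?orbT // => nBe.
      rewrite (_ : e \in R0) ?orbT //; apply: (subsetP sTR).
      by rewrite !inE nBe Te; apply/andP; split=> //; apply/eqP.
    have [eT|eT] := disjoint_pair_alone k3 kF tF FS FB FT dS sT.
      by rewrite eT dS in dT.
    by rewrite eT eqxx in nTB.
  by rewrite cardsDS // cR in sub.
rewrite inE => /and3P[sR /eqP cR _].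
have cU : #|(x |: R) :|: B| <= 2 * k.
  apply: leq_trans (card_setU_le (card_setU1_le x (eq_leq cR)) (eq_leq (kF FB))) _.
  by arith.
apply: leq_trans (leq_bin2l k cU); rewrite -cards_draws.
apply/subset_leq_card/subsetP => T; rewrite !inE => /andP[/andP[FT _] sT].
rewrite kF // eqxx andbT; apply/subsetP => e Te; rewrite !inE.
case: eqP => //= nex; case: (boolP (e \in B)); rewrite ?orbT // => nBe.
rewrite (subsetP sT) // !inE nBe Te andbT andbT; exact/eqP.
Qed.

(** The sets disjoint from [B] pairwise intersect, so each contains one of the k points of a fixed
    one, [T0]. The sets meeting [B] once are determined by their rest, by [card_trace1_sub] with the
    single block [B]. *)
Lemma card_off_star :
    (forall C C', C \in F -> C' \in F -> [disjoint C & C'] -> [disjoint C & B] ->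
       [disjoint C' & B] -> False) ->
  #|E| <= (k + 1) * 'C(#|Z|, k - 1).
Proof.
move=> no3; have sZ T : T \in E -> T :\: B \subset Z.
  by move=> ET; apply: (bigcup_sup T).
apply: leq_trans (_ : _ <= k * 'C(#|Z|, k - 1) + 'C(#|Z|, k - 1)) _; last by arith.
pose E0 := [set T in E | [disjoint T & B]].
pose E1 := [set T in E | #|T :&: B| == 1].
apply: (@leq_trans #|E0 :|: E1|).
  apply/subset_leq_card/subsetP => T ET; rewrite 2!inE ET /= inE ET /=.
  move: ET; rewrite inE => /and3P[_ _]; rewrite leq_eqVlt ltnS leqn0 cards_eq0.
  by rewrite setI_eq0 orbC.
have EF T : T \in E -> T \in F by rewrite inE => /andP[].
apply: card_setU_le.
  case: (set_0Vmem E0) => [->|[T0 ET0]]; first by rewrite cards0.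
  move: (ET0); rewrite inE => /andP[/EF FT0 dT0].
  rewrite -[X in X * _](kF FT0) -[X in X <= _]muln1.
  apply: (double_count (r := fun (T : {set V}) v => v \in T)) => [T|v Tv].
    rewrite inE => /andP[/EF FT dT]; rewrite card_gt0; apply/negP => /eqP e0.
    apply: (no3 _ _ FT0 FT _ dT0 dT); rewrite -setI_eq0; apply/eqP/setP => e.
    by move/setP/(_ e): e0; rewrite !inE.
  apply: leq_trans (_ : _ <= 'C(#|Z| - #|[set v]|, k - #|[set v]|)) _; last first.
    by rewrite cards1; apply: leq_bin2l; arith.
  apply: leq_trans (card_supersets [set v] Z k); apply/subset_leq_card/subsetP => T.
  rewrite !inE sub1set => /andP[/andP[ET dT] ->].
  have ETT : T \in E by rewrite inE.
  rewrite (kF (EF _ ETT)) eqxx !andbT -(_ : T :\: B = T) ?sZ //.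
  exact/setDidPl.
apply: (card_trace1_sub (K := [set B]) k3 kF tF).
- by rewrite sub1set.
- by apply/subsetP => T; rewrite inE => /andP[/EF].
move=> T; rewrite inE cover1 => /andP[ET /eqP ->]; split => //; exact: sZ.
Qed.

(* T and the star set x, u, Q are disjoint and contain the star set x, z, Q in
   their union. *)
Let dead T z u (Q : {set V}) : T \in E -> z \in T -> [disjoint Q & T] ->
  u \in Y -> u \notin T -> u \notin Q -> z |: Q \in P -> u |: Q \in P -> False.
Proof.
rewrite inE => /and3P[FT xT _] Tz dQT Yu nTu nQu.
rewrite !inE => /and3P[_ _ FS'] /and3P[_ _ FS].
have ux : u != x by apply: contraNneq xY => <-.
have dTS : [disjoint T & x |: (u |: Q)].
  rewrite -setI_eq0; apply/eqP/setP => e; rewrite !inE.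
  apply/negP => /andP[Te /or3P[/eqP E'|/eqP E'|Qe]].
  - by rewrite -E' Te in xT.
  - by rewrite -E' Te in nTu.
  by rewrite (disjointFr dQT Qe) in Te.
have sS : x |: (z |: Q) \subset T :|: (x |: (u |: Q)).
  apply/subsetP => e; rewrite !inE => /or3P[->|/eqP ->|->]; rewrite ?orbT //.
  by rewrite Tz.
have [eS|/setP/(_ u)] := disjoint_pair_alone k3 kF tF FT FS FS' dTS sS.
  by rewrite -eS !inE eqxx in xT.
rewrite !inE eqxx (negPf nQu) (negPf ux) orbF /= => /eqP uz.
by rewrite uz Tz in nTu.
Qed.

(** A chosen off-star member through [z]; the default [set0] occurs only for [z] outside [Z]. *)
Let tz z := odflt set0 [pick T in E | z \in T :\: B].

Let tzP z : z \in Z -> [/\ tz z \in E, z \in tz z, z \in Y & #|tz z| = k].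
Proof.
move=> /bigcupP[T ET Tz]; rewrite /tz; case: pickP => [T'|/(_ T)]; last by rewrite ET Tz.
move=> /andP[ET' /setDP[Tz' nBz]]; split=> //=.
  rewrite !inE negb_or nBz andbT; apply: contraTneq ET' => zx.
  by rewrite inE -zx Tz' andbF.
by apply: kF; move: ET'; rewrite inE => /andP[].
Qed.

Let ZY : Z \subset Y.
Proof. by apply/subsetP => z /tzP[]. Qed.

(** Let a present [R] contain some [z] in [Z]. If [R :\ z] meets [tz z], then [R] is counted by [z],
    a second point from the k points of [tz z], and k - 3 others. If not, [dead] forces every
    present extension of [R :\ z] to add a point of [tz z], so this (k-2)-set has at most k of
    them. *)
Lemma card_present : #|P| <= 'C(#|Y| - #|Z|, k - 1) + k * 'C(#|Y|, k - 2)
  + #|Z| * (k * 'C(#|Y| - 2, k - 3)).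
Proof.
pose e (Q : {set V}) := #|[set R in P | Q \subset R]|.
pose P1 := [set R in P | [exists Q : {set V}, [&& Q \subset R, #|Q| == k - 2 & e Q <= k]]].
pose P2 := [set R in P | [exists z in Z, (z \in R) && ~~ [disjoint R :\ z & tz z]]].
have PE R : R \in P -> [/\ R \subset Y, #|R| = k - 1 & x |: R \in F].
  by rewrite inE => /and3P[? /eqP].
apply: (@leq_trans #|[set R : {set V} | R \subset Y :\: Z & #|R| == k - 1] :|: P1 :|: P2|).
  apply/subset_leq_card/subsetP => R PR; have [sR cR _] := PE R PR.
  case: (boolP (R \subset Y :\: Z)) => [s|]; first by rewrite !inE s cR eqxx.
  move=> /subsetPn[z Rz]; rewrite inE (subsetP sR z Rz) andbT negbK => Zz.
  have [ET Tz Yz cT] := tzP Zz.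
  case: (boolP [disjoint R :\ z & tz z]) => dT; last first.
    rewrite 2!inE; apply/orP; right; rewrite inE PR.
    by apply/existsP; exists z; rewrite Zz Rz.
  rewrite 2!inE; apply/orP; left; apply/orP; right; rewrite inE PR.
  apply/existsP; exists (R :\ z).
  have cRz : #|R :\ z| = k - 2 by have := cardsD1 z R; rewrite Rz cR; arith.
  rewrite subD1set cRz eqxx /= -cT.
  apply: leq_trans (leq_imset_card (fun u => u |: (R :\ z)) (mem (tz z))).
  apply/subset_leq_card/subsetP => R'; rewrite inE => /andP[PR' sR'].
  have [sR'Y cR' _] := PE R' PR'.
  have [|u nu eR'] := setU1_subset sR'; first by rewrite cR' cRz; arith.
  apply/imsetP; exists u => //; apply: contraT => nTu; exfalso.
  apply: (dead ET Tz dT _ nTu nu); rewrite ?setD1K // -?eR' //.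
  by apply: (subsetP sR'Y); rewrite eR' !inE eqxx.
apply: card_setU_le; first apply: card_setU_le.
- by rewrite cards_draws cardsDS.
- rewrite mulnC -[X in X <= _]muln1.
  apply: leq_trans (_ : _ <=
    #|[set Q : {set V} | [&& Q \subset Y, #|Q| == k - 2 & e Q <= k]]| * k) _.
    apply: (double_count (r := fun R Q : {set V} => Q \subset R)) => [R|Q].
      rewrite inE => /andP[/PE[sR _ _] /existsP[Q /and3P[sQ cQ eQ]]].
      by apply/card_gt0P; exists Q; rewrite !inE cQ eQ sQ (subset_trans sQ sR).
    rewrite inE => /and3P[_ _]; apply: leq_trans; apply/subset_leq_card/subsetP => R.
    by rewrite !inE -!andbA => /and5P[-> -> -> _].
  rewrite leq_mul2r -cards_draws; apply/orP; right.
  by apply/subset_leq_card/subsetP => Q; rewrite !inE => /and3P[-> ->].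
rewrite -[X in X <= _]muln1.
apply: (double_count (r := fun (R : {set V}) z => (z \in R) && ~~ [disjoint R :\ z & tz z])).
  move=> R; rewrite inE => /andP[_ /existsP[z /andP[Zz Hz]]].
  by apply/card_gt0P; exists z; rewrite inE Zz.
move=> z Zz; have [_ _ _ cT] := tzP Zz.
rewrite -[X in X * _]cT -[X in X <= _]muln1.
apply: (double_count (r := fun (R : {set V}) v => v \in R :\ z)) => [R|v Tv].
  rewrite inE -setI_eq0 => /and3P[_ _ /set0Pn[v /setIP[Rv Tv]]].
  by apply/card_gt0P; exists v; rewrite inE Tv.
case: (eqVneq v z) => [->|nvz].
  by rewrite (_ : [set _ in _ | _] = set0) ?cards0 //; apply/setP => R; rewrite !inE eqxx andbF.
have c2 : #|[set v; z]| = 2 by rewrite cards2 nvz.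
rewrite (_ : k - 3 = (k - 1) - #|[set v; z]|); last by rewrite c2; arith.
rewrite -[X in 'C(_ - X, _)]c2.
apply: leq_trans (card_supersets [set v; z] Y (k - 1)).
apply/subset_leq_card/subsetP => R.
rewrite inE => /andP[+ Rv]; rewrite inE => /and3P[+ Rz _].
case/setIdP => /PE[sR cR _] _; rewrite inE sR cR eqxx.
by rewrite subUset !sub1set Rz andbT; case/setD1P: Rv.
Qed.

(** Count pairs of a point [z] of [Z] and a lost set through it. Take a (k-2)-set [D] in [Y] off
    [tz z]: either [z |: D] is lost, or by [dead] all sets [u |: D] with [u] in [Y] off [tz z] and
    [D] are lost. As a lost set has only k - 1 subsets [D], the second case is rare, which gives the
    subtracted quotient. *)
Lemma card_support : 2 * k - 2 < #|Y| ->
  #|Z| * ('C(#|Y| - k, k - 2) - #|L| * (k - 1) %/ (#|Y| - k - (k - 2)))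
    <= #|L| * (k - 1).
Proof.
move=> leY; set p := _ - _; apply: (double_count (r := fun z (R : {set V}) => z \in R)) => [z Zz|R].
  rewrite {}/p; have [ET Tz Yz cT] := tzP Zz.
  pose Q := [set Q : {set V} | Q \subset Y :\: tz z & #|Q| == k - 2].
  pose Q1 := [set D in Q | z |: D \in L].
  have cQ1 : #|Q1| <= #|[set R in L | z \in R]|.
    rewrite -(@card_in_imset _ _ (fun D => z |: D) (mem Q1)).
      apply/subset_leq_card/subsetP => _ /imsetP[D + ->].
      by case/setIdP => _ LD; rewrite inE LD !inE eqxx.
    have nz D : D \in Q1 -> z \notin D.
      case/setIdP => /setIdP[sD _] _.
      by apply: contraL Tz => /(subsetP sD); rewrite inE => /andP[].
    by move=> D D' /nz nD /nz nD' eD; rewrite -(setU1K nD) eD setU1K.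
  have cQ2 : #|Q :\: Q1| * (#|Y| - k - (k - 2)) <= #|L| * (k - 1).
    apply: (double_count (r := fun D R : {set V} => D \subset R)) => [D|R].
      rewrite inE => /andP[nQ1 QD]; move: (QD); rewrite inE => /andP[sD /eqP cD].
      have sDY : D \subset Y by apply: subset_trans sD (subsetDl _ _).
      have dDT : [disjoint D & tz z].
        rewrite -setI_eq0; apply/eqP/setP => e; rewrite !inE; apply/negP.
        by move=> /andP[/(subsetP sD)]; rewrite inE => /andP[/negPf->].
      apply: leq_trans (_ : _ <= #|(Y :\: tz z) :\: D|) _.
        rewrite cardsDS // cD leq_sub2r // cardsD leq_sub2l //.
        by rewrite -cT subset_leq_card ?subsetIr.
      apply: (@card_add1 _ D) => [|u].
        rewrite -setI_eq0; apply/eqP/setP => e; rewrite !inE.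
        by case: (e \in D).
      move=> /setDP[/setDP[Yu nTu] nDu]; rewrite inE subsetUr andbT.
      have sub v : v \in Y -> v |: D \subset Y by move=> Yv; rewrite subUset sub1set Yv.
      have cv v : v \notin D -> #|v |: D| == k - 1.
        by move=> nv; rewrite cardsU1 nv cD; arith.
      have nzD : z \notin D by rewrite (disjointFl dDT).
      have PzD : z |: D \in P.
        have : z |: D \notin L.
          by apply: contra nQ1 => LD; apply/setIdP.
        by rewrite inE sub // cv //= negbK inE sub // cv.
      apply: contraT; rewrite inE sub // cv //= negbK => FuD; exfalso.
      by apply: (dead ET Tz dDT Yu nTu nDu PzD); rewrite inE sub // cv.
    rewrite inE => /and3P[_ /eqP cR _].
    apply: (@leq_trans 'C(#|R|, k - 2)).
      rewrite -cards_draws; apply/subset_leq_card/subsetP => D; rewrite !inE.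
      by move=> /andP[/and3P[_ _ ->] ->].
    rewrite cR -bin_sub; last by arith.
    by rewrite (_ : k - 1 - (k - 2) = 1) ?bin1; last by arith.
  have cQ : 'C(#|Y| - k, k - 2) <= #|Q|.
    rewrite cards_draws leq_bin2l // cardsD leq_sub2l //.
    by rewrite -cT subset_leq_card ?subsetIr.
  have d0 : 0 < #|Y| - k - (k - 2) by arith.
  have := leq_div2r (#|Y| - k - (k - 2)) cQ2; rewrite mulnK //.
  have sQ1 : Q1 \subset Q by apply/subsetP => D; rewrite inE => /andP[].
  by rewrite cardsDS //; arith.
rewrite inE => /and3P[_ /eqP <- _]; apply/subset_leq_card/subsetP => z.
by rewrite inE => /andP[].
Qed.

End Star.

(** * Binomial estimates *)

(* With equality for k = 3. *)
Lemma central_bin_bound k : 3 <= k -> 20 * k ^ 4 <= 81 * 'C(2 * k, k).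
Proof.
elim: k => // k IH; rewrite leq_eqVlt => /predU1P[<- //|k3].
have {IH k3} [k3 IH] : 3 <= k /\ 20 * k ^ 4 <= 81 * 'C(2 * k, k).
  by split; last apply: IH; lia.
have e1 : 'C(2 * k.+1, k.+1) = 2 * 'C((2 * k).+1, k.+1).
  rewrite (_ : 2 * k.+1 = (2 * k).+2) ?binS; last by lia.
  have := @bin_sub (2 * k).+1 k.
  rewrite (_ : (2 * k).+1 - k = k.+1); last by lia.
  by move=> <-; rewrite ?mul2n ?addnn //; lia.
have e2 : k.+1 * 'C((2 * k).+1, k.+1) = (2 * k).+1 * 'C(2 * k, k).
  by rewrite -mul_bin_diag.
rewrite -(leq_pmul2l (ltn0Sn k)) e1.
have -> : k.+1 * (81 * (2 * 'C((2 * k).+1, k.+1)))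
       = 2 * (2 * k).+1 * (81 * 'C(2 * k, k)) by lia.
apply: leq_trans (_ : 2 * (2 * k).+1 * (20 * k ^ 4) <= _); last first.
  by rewrite leq_mul2l IH orbT.
have h4 : 3 ^ 4 * k.+1 ^ 4 <= 4 ^ 4 * k ^ 4.
  by rewrite -!expnMn leq_exp2r //; lia.
have h5 : 4 ^ 4 * k.+1 <= 3 ^ 4 * (2 * (2 * k).+1) by lia.
have := leq_mul h4 h5.
have -> : 3 ^ 4 * k.+1 ^ 4 * (4 ^ 4 * k.+1) = 3 ^ 4 * 4 ^ 4 * (k.+1 * k.+1 ^ 4) by lia.
have -> : 4 ^ 4 * k ^ 4 * (3 ^ 4 * (2 * (2 * k).+1))
       = 3 ^ 4 * 4 ^ 4 * (2 * (2 * k).+1 * k ^ 4) by lia.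
by rewrite leq_pmul2l // mulnCA [X in _ -> _ <= X]mulnCA leq_mul2l => ->.
Qed.

(** C(a, j) / C(b, j) is a product of j factors (a - l) / (b - l), each at most a / b <= 1; only i
    of them are kept as a / b. *)
Lemma bin_ratio a b i j : a <= b -> i <= j -> 'C(a, j) * b ^ i <= 'C(b, j) * a ^ i.
Proof.
move=> ab ij; rewrite -(leq_pmul2r (fact_gt0 j)) mulnAC [X in _ <= X]mulnAC.
rewrite !bin_ffact; elim: j i ij => [|j IH] i; first by rewrite leqn0 => /eqP->.
rewrite !ffactnSr leq_eqVlt => /predU1P[->|ij]; last first.
  rewrite mulnAC [X in _ <= X]mulnAC; apply: leq_mul; first exact: IH.
  exact: leq_sub2r.
rewrite !expnSr mulnACA [X in _ <= X]mulnACA; apply: leq_mul; first exact: IH.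
by rewrite !mulnBl mulnC leq_sub2l // leq_mul2l ab orbT.
Qed.

Lemma bin_tenth a b j : 10 * a <= b -> 'C(a, j) * 10 ^ j <= 'C(b, j).
Proof.
case: a => [|a] ab; first by case: j => [|j]; rewrite ?bin0 ?bin0n.
have ab' : a.+1 <= b by lia.
rewrite -(@leq_pmul2r (a.+1 ^ j)) ?expn_gt0 //.
apply: leq_trans (bin_ratio ab' (leqnn j)).
by rewrite -mulnA -expnMn leq_mul2l; apply/orP; right; case: j => // j; rewrite leq_exp2r.
Qed.

Lemma bin_add_lower u d j : 'C(u, j.+1) + d * 'C(u, j) <= 'C(u + d, j.+1).
Proof.
elim: d => [|d IH]; first by rewrite !addn0.
rewrite addnS binS mulSn; have : 'C(u, j) <= 'C(u + d, j) by apply/leq_bin2l/leq_addr.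
by lia.
Qed.

Lemma bin_add_upper u d j : 'C(u + d, j.+1) <= 'C(u, j.+1) + d * 'C((u + d).-1, j).
Proof.
elim: d => [|d IH]; first by rewrite !addn0.
rewrite addnS binS mulSn /=.
have : 'C((u + d).-1, j) <= 'C(u + d, j) by apply/leq_bin2l/leq_pred.
by nia.
Qed.

(** Lowering the top entry by d loses at most the fraction d j / s, because C(s - 1, j - 1) = (j /
    s) C(s, j). *)
Lemma bin_shift s d j : d <= s -> 'C(s, j) * s <= 'C(s - d, j) * s + d * j * 'C(s, j).
Proof.
case: j => [|j] ds; first by rewrite !bin0; lia.
have := bin_add_upper (s - d) d j; rewrite subnK // => h.
have := mul_bin_diag s j => h'.
apply: leq_trans (_ : ('C(s - d, j.+1) + d * 'C(s.-1, j)) * s <= _).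
  by rewrite leq_mul2r h orbT.
by rewrite mulnDl leq_add2l -!mulnA -h' [s * _]mulnC.
Qed.

Lemma bin_shift_half s d j : d <= s -> 2 * d * j <= s -> 'C(s, j) <= 2 * 'C(s - d, j).
Proof.
move=> ds dj; case: (posnP s) => [s0|s0].
  have -> : s - d = s by lia.
  by lia.
rewrite -(leq_pmul2r s0); have := bin_shift j ds.
have : 2 * d * j * 'C(s, j) <= s * 'C(s, j) by rewrite leq_mul2r dj orbT.
by nia.
Qed.

Lemma mul6_bin3 m : 6 * 'C(m, 3) = m * (m - 1) * (m - 2).
Proof.
have := bin_ffact m 3; rewrite (_ : 3`! = 6) // mulnC => ->.
by rewrite ffactnSr ffactnSr ffactn1.
Qed.

Lemma mul2_bin2 m : 2 * 'C(m, 2) = m * (m - 1).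
Proof. by have := bin_ffact m 2; rewrite mulnC => ->; rewrite ffactnSr ffactn1. Qed.

(** To [lia] the powers of [t] are atoms; their signs make the polynomial inequalities below
    linear. *)
Ltac monomials t :=
  have := leq0n (t * t); have := leq0n (t * t * t);
  have := leq0n (t * t * t * t); have := leq0n (t * t * t * t * t).

(** The hypothesis on n enters most estimates only through this polynomial consequence: 3k times 20
    k^4 / 81 is 20 k^5 / 27. *)
Lemma ground_bound k n : 3 <= k -> 3 * k * 'C(2 * k, k) <= n ->
  20 * (k * k * k * k * k) <= 27 * n.
Proof.
move=> k3 hn; have := central_bin_bound k3; rewrite !expnS expn0 muln1 => hc.
rewrite -(@leq_pmul2l 3) //.
have : 3 * k * (20 * (k * (k * (k * k)))) <= 3 * k * (81 * 'C(2 * k, k)).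
  by rewrite leq_mul2l hc orbT.
have : 81 * (3 * k * 'C(2 * k, k)) <= 81 * n by rewrite leq_mul2l hn.
by lia.
Qed.

(** With u = n - 3k, [bin_ratio] bounds the first term by (1 - z / u) C(u, k - 1), so it suffices
    that u times the coefficient of z is at most C(u, k - 1) ([hX]). There C(n - 3, k - 3) is at
    most 2 C(u, k - 3), and two steps down the row u gain a factor of order u^2 / k^2. *)
Lemma shadow_ineq k n z : 3 <= k -> 20 * (k * k * k * k * k) <= 27 * n ->
  z <= n - 3 * k ->
  'C(n - 3 * k - z, k - 1) + z * ('C(k - 1, 2) * 'C(n - 3, k - 3))
    <= 'C(n - 3 * k, k - 1).
Proof.
case: k => [|[|[|t]]] // _ hn zu.
have [-> ->] : t.+3 - 1 = t.+2 /\ t.+3 - 3 = t by lia.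
have f1 : (t + 2) * (t + 2) * (t + 1) * (t + 1) + 2 * t + 1 + 3 * t.+3 <= n.
  by monomials t; lia.
have f2 : 2 * (3 * t.+3 - 3) * t <= n - 3 by monomials t; lia.
have f3 : 3 * t.+3 - 3 <= n - 3 by lia.
have h2 := bin_shift_half f3 f2.
rewrite (_ : n - 3 - (3 * t.+3 - 3) = n - 3 * t.+3) in h2; last by lia.
have f4 : (t + 2) * (t + 2) * (t + 1) * (t + 1) + 2 * t + 1 <= n - 3 * t.+3 by lia.
move: (n - 3 * t.+3) zu h2 f4 => u zu h2 f4.
have e1 := mul_bin_left u t; have e2 := mul_bin_left u t.+1.
set c := 'C(u, t) in h2 e1; set M := 'C(u, t.+1) in e1 e2.
set X := 'C(u, t.+2) in e2 *.
have e0 := mul2_bin2 t.+2.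
have f5 : u * ((t + 2) * (t + 2) * (t + 1) * (t + 1)) <= (u - t) * (u - t.+1).
  have [w uw] : exists w, u = w + t.+1 by exists (u - t.+1); lia.
  rewrite uw; have [-> ->] : w + t.+1 - t = w.+1 /\ w + t.+1 - t.+1 = w by lia.
  move: f4; rewrite uw; move: (_ * _ * _ * _) => b f4.
  have [d ->] : exists d, w = b + t + d by exists (w - (b + t)); lia.
  have := leq0n (d * b); have := leq0n (t * t); have := leq0n (t * d).
  by have := leq0n (d * d); lia.
have hX : u * ('C(t.+2, 2) * 'C(n - 3, t)) <= X.
  rewrite -(@leq_pmul2l ((t + 1) * (t + 2))); last by lia.
  have -> : (t + 1) * (t + 2) * X = (u - t) * (u - t.+1) * c.
    rewrite -mulnA (_ : t + 2 = t.+2) ?e2; last by lia.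
    by rewrite mulnCA (_ : t + 1 = t.+1) ?e1; lia.
  apply: leq_trans (_ : u * ((t + 2) * (t + 2) * (t + 1) * (t + 1)) * c <= _); last first.
    by rewrite leq_mul2r f5 orbT.
  apply: (@leq_trans ((t + 1) * (t + 2) * (u * ('C(t.+2, 2) * (2 * c))))).
    by rewrite !leq_mul2l h2 !orbT.
  have -> : (t + 1) * (t + 2) * (u * ('C(t.+2, 2) * (2 * c)))
     = (t + 1) * (t + 2) * u * c * (2 * 'C(t.+2, 2)) by lia.
  by rewrite e0 (_ : t.+2 - 1 = t.+1); lia.
case: (posnP u) => [u0|u0]; first by rewrite (_ : z = 0) ?subn0 ?mul0n ?addn0; lia.
rewrite -(leq_pmul2r u0) mulnDl.
have r := @bin_ratio (u - z) u 1 t.+2 (leq_subr _ _) isT.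
rewrite !expn1 in r; apply: leq_trans (leq_add r (leqnn _)) _.
rewrite -mulnA [_ * u]mulnC.
apply: (@leq_trans (X * (u - z) + z * X)); first by rewrite leq_add2l leq_mul2l hX orbT.
by rewrite [z * X]mulnC -mulnDr subnK.
Qed.

(** Passing from n - 3k to n - k - 1 adds at least 2k - 1 copies of C(n - 3k, k - 2): 2k - 3 of them
    match the second term, and the remaining two dominate the third. *)
Lemma three_disjoint_ineq k n : 3 <= k -> 20 * (k * k * k * k * k) <= 27 * n ->
  'C(n - 3 * k, k - 1) + 'C(n - 3 * k, k - 2) * (2 * k - 3)
    + 'C(3 * k, 3) * 'C(n - 3, k - 3) <= 'C(n - k - 1, k - 1).
Proof.
case: k => [|[|[|t]]] // _ hn.
have [-> -> ->] : [/\ t.+3 - 1 = t.+2, t.+3 - 2 = t.+1 & t.+3 - 3 = t] by split; lia.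
have e3 := mul6_bin3 (3 * t.+3).
have f1 : (3 * t.+3) * (3 * t.+3 - 1) * (3 * t.+3 - 2) * t.+1 + 6 * t + 18 * t.+3 <= 6 * n.
  have [-> ->] : 3 * t.+3 - 1 = 3 * t + 8 /\ 3 * t.+3 - 2 = 3 * t + 7 by lia.
  by monomials t; lia.
have f2 : 2 * (3 * t.+3 - 3) * t <= n - 3 by monomials t; lia.
have f3 : 3 * t.+3 - 3 <= n - 3 by monomials t; lia.
have h2 := bin_shift_half f3 f2.
rewrite (_ : n - 3 - (3 * t.+3 - 3) = n - 3 * t.+3) in h2; last by lia.
rewrite -e3 in f1; have f4 : 'C(3 * t.+3, 3) * t.+1 <= n - 3 * t.+3 - t by lia.
have -> : n - t.+3 - 1 = n - 3 * t.+3 + (2 * t.+3 - 1) by lia.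
move: (n - 3 * t.+3) h2 f4 => u h2 f4.
have e1 := mul_bin_left u t.
apply: leq_trans (bin_add_lower _ _ _).
have -> : 2 * t.+3 - 1 = (2 * t.+3 - 3) + 2 by lia.
rewrite mulnDl -addnA leq_add2l [_ * (_ - 3)]mulnC leq_add2l.
rewrite -(@leq_pmul2l t.+1) // [X in _ <= X]mulnCA e1.
apply: (@leq_trans (t.+1 * ('C(3 * t.+3, 3) * (2 * 'C(u, t))))).
  by rewrite !leq_mul2l h2 !orbT.
have -> : t.+1 * ('C(3 * t.+3, 3) * (2 * 'C(u, t)))
  = 2 * (('C(3 * t.+3, 3) * t.+1) * 'C(u, t)) by lia.
by rewrite leq_mul2l leq_mul2r f4 orbT.
Qed.

Lemma quadratic_beats u a b f g m :
  b <= m * u -> f * (a + m) < g * (u - 1) -> f * (a * u + b) < g * (u * (u - 1)).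
Proof.
move=> hb h; have u0 : 0 < u by case: u h {hb}; lia.
apply: (@leq_ltn_trans (u * (f * (a + m)))).
  have : f * b <= f * (m * u) by rewrite leq_mul2l hb orbT.
  by lia.
by rewrite [X in _ < X]mulnCA ltn_pmul2l.
Qed.

(* [e1] and [e2] bound the lower order terms of the hypotheses of [final_bound]. *)
Lemma error_ineqs t N (M := 'C(N, t.+1)) (c := 'C(N, t))
    (e1 := (t + 3) * M + N * ((t + 3) * c))
    (e2 := M * (2 * t + 3) + 2 * 'C(2 * t + 6, 3) * c) :
    20 * ((t + 3) * (t + 3) * (t + 3) * (t + 3) * (t + 3)) <= 27 * (N + t + 4) ->
  50 * (e1 + e2) < 9 * 'C(N, t.+2) /\ 10 * (2 * (t + 3) * e1 + e2) < 9 * 'C(N, t.+2).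
Proof.
move=> hn.
have ltN : t + 8 <= N by monomials t; lia.
have c0 : 0 < c by rewrite bin_gt0; lia.
have b3 : 3 * 'C(2 * t + 6, 3) = (t + 3) * (2 * t + 5) * (2 * t + 4).
  have := mul6_bin3 (2 * t + 6).
  have -> : 2 * t + 6 - 1 = 2 * t + 5 by lia.
  have -> : 2 * t + 6 - 2 = 2 * t + 4 by lia.
  by lia.
have hM := mul_bin_left N t; have hX := mul_bin_left N t.+1.
rewrite -/M -/c in hM; rewrite -/M in hX.
set X := 'C(N, t.+2) in hX *.
have [u Nu] : exists u, N = u + t by exists (N - t); lia.
have E1 : N - t = u by lia.
have E2 : N - t.+1 = u - 1 by lia.
rewrite {}E1 in hM; rewrite {}E2 in hX.
(* Multiplied by (t + 1)(t + 2), the terms [X], [e1] and [e2] become polynomials in [u] times [c],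
   and [c] cancels. *)
have hXc : (t + 1) * (t + 2) * X = u * (u - 1) * c.
  have -> : (t + 1) * (t + 2) * X = t.+1 * (t.+2 * X) by lia.
  by rewrite hX mulnCA hM; lia.
have hu : 20 * ((t + 3) * (t + 3) * (t + 3) * (t + 3) * (t + 3)) <= 27 * u + 27 * (2 * t + 4) by lia.
move: ('C(2 * t + 6, 3)) @e2 b3 => b e2 b3.
have he1 : (t + 1) * (t + 2) * e1
    = ((t + 3) * (t + 2) * u + (u + t) * ((t + 3) * (t + 1) * (t + 2))) * c.
  rewrite /e1 Nu.
  have -> : (t + 1) * (t + 2) * ((t + 3) * M + (u + t) * ((t + 3) * c))
    = (t + 3) * (t + 2) * (t.+1 * M) + (u + t) * ((t + 3) * (t + 1) * (t + 2)) * c by lia.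
  by rewrite hM; lia.
have he2 : (t + 1) * (t + 2) * e2
    = ((2 * t + 3) * (t + 2) * u + 2 * b * ((t + 1) * (t + 2))) * c.
  rewrite /e2.
  have -> : (t + 1) * (t + 2) * (M * (2 * t + 3) + 2 * b * c)
    = (2 * t + 3) * (t + 2) * (t.+1 * M) + 2 * b * ((t + 1) * (t + 2)) * c by lia.
  by rewrite hM; lia.
clearbody e1 e2 M c X.
have bb : 3 * (2 * b * ((t + 1) * (t + 2)))
   = 2 * ((t + 3) * (2 * t + 5) * (2 * t + 4)) * ((t + 1) * (t + 2)) by rewrite -b3; lia.
have T : 0 < (t + 1) * (t + 2) by rewrite muln_gt0; lia.
split; rewrite -(ltn_pmul2l T).
- have -> : (t + 1) * (t + 2) * (9 * X) = 9 * (u * (u - 1)) * c by rewrite mulnCA hXc mulnA.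
  have -> : (t + 1) * (t + 2) * (50 * (e1 + e2))
     = 50 * ((t + 1) * (t + 2) * e1 + (t + 1) * (t + 2) * e2) by lia.
  rewrite he1 he2 -mulnDl mulnA ltn_pmul2r //.
  pose a := 3 * (t + 2) * (t + 2) + (t + 1) * (t + 2) * (t + 3).
  pose bt := t * ((t + 3) * (t + 1) * (t + 2)) + 2 * b * ((t + 1) * (t + 2)).
  rewrite (_ : _ + _ = a * u + bt); last by rewrite /a /bt; lia.
  by apply: (@quadratic_beats u a bt 50 9 5); rewrite /a /bt; monomials t; lia.
have -> : (t + 1) * (t + 2) * (9 * X) = 9 * (u * (u - 1)) * c by rewrite mulnCA hXc mulnA.
have -> : (t + 1) * (t + 2) * (10 * (2 * (t + 3) * e1 + e2))
   = 10 * (2 * (t + 3) * ((t + 1) * (t + 2) * e1) + (t + 1) * (t + 2) * e2) by lia.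
rewrite he1 he2 [2 * (t + 3) * _]mulnA -mulnDl mulnA ltn_pmul2r //.
pose a := 2 * (t + 3) * (t + 3) * (t + 2) + 2 * (t + 3) * (t + 3) * (t + 1) * (t + 2)
          + (2 * t + 3) * (t + 2).
pose bt := 2 * (t + 3) * (t + 3) * t * (t + 1) * (t + 2) + 2 * b * ((t + 1) * (t + 2)).
rewrite (_ : _ + _ = a * u + bt); last by rewrite /a /bt; lia.
by apply: (@quadratic_beats u a bt 10 9 7); rewrite /a /bt; monomials t; lia.
Qed.

(** With k = t + 3, this turns the power of 10 from [bin_tenth] into a factor linear in k. *)
Lemma pow_tenth t : 5 * (t + 4) <= 2 * 10 ^ t.+1.
Proof. by elim: t => // t IH; rewrite expnS; lia. Qed.

(** The premises give 100 z w < 9 (z + w)^2, that is (9z - w)(z - 9w) > 0, and the last one makes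
    the first factor positive. *)
Lemma square_split z w X e : 0 < X ->
  50 * e < 9 * X -> X * (z + w) ^ 2 <= X * (z ^ 2 + w ^ 2) + e * (z + w) ^ 2 ->
  w < 9 * z -> 9 * w < z.
Proof.
move=> X0 he; rewrite !expnS !expn0 !muln1 => h wz.
have N0 : 0 < (z + w) * (z + w) by rewrite muln_gt0; lia.
have {}he : 50 * e * ((z + w) * (z + w)) < 9 * X * ((z + w) * (z + w)) by rewrite ltn_pmul2r.
have : X * (100 * (z * w)) < X * (9 * ((z + w) * (z + w))) by lia.
rewrite ltn_pmul2l // => {}h; rewrite ltnNge; apply/negP => zw.
have : (9 * z - w) * z <= (9 * z - w) * (9 * w) by rewrite leq_mul2l zw orbT.
rewrite !mulnBl; have : w * z <= 9 * z * z by rewrite leq_mul2r; lia.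
have : w * (9 * w) <= 9 * z * (9 * w) by rewrite leq_mul2r; lia.
by lia.
Qed.

Lemma final_bound k n N z P L K E F1 F :
  n = N + k + 1 -> 3 <= k -> 3 * k * 'C(2 * k, k) <= n -> z <= N ->
  F <= F1 + 'C(n - 2 * k, k - 2) * (2 * k - 3) + 'C(2 * k, 3) * 'C(n - 3, k - 3) ->
  F1 <= 'C(z, k - 1) + P -> F1 <= 2 * k * P ->
  P <= 'C(N - z, k - 1) + k * 'C(N, k - 2) + z * (k * 'C(N - 2, k - 3)) ->
  F <= 1 + P + K + E -> P + L = 'C(N, k - 1) ->
  K * (N - (k - 2)) <= L * 'C(2 * k, k) ->
  E <= (k + 1) * 'C(z, k - 1) ->
  z * ('C(N - k, k - 2) - L * (k - 1) %/ (N - k - (k - 2))) <= L * (k - 1) ->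
  F <= 'C(N, k - 1) + 1.
Proof.
move=> nN k3 hn; have := ground_bound k3 hn.
case: k k3 nN hn => [|[|[|t]]] // _ nN.
have [-> -> ->] : [/\ t.+3 - 1 = t.+2, t.+3 - 2 = t.+1 & t.+3 - 3 = t] by split; lia.
move=> hn hg zN hF hF1 hF1' hP hF' PL hK hE hZ.
have hg' : 20 * ((t + 3) * (t + 3) * (t + 3) * (t + 3) * (t + 3)) <= 27 * n.
  by rewrite (_ : t + 3 = t.+3) //; lia.
have hlin : 100 * t.+3 <= 2 * n by move: hg'; clear; monomials t; lia.
have bigN : 10 * ((t + 3) * (t + 1)) + 11 * t + 80 <= N.
  by move: hg' nN; clear; monomials t; lia.
have {}nN : n = N + t + 4 by clear -nN; lia.
have [A1 A2] : 50 * ((t + 3) * 'C(N, t.+1) + N * ((t + 3) * 'C(N, t))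
    + ('C(N, t.+1) * (2 * t + 3) + 2 * 'C(2 * t + 6, 3) * 'C(N, t))) < 9 * 'C(N, t.+2)
  /\ 10 * (2 * (t + 3) * ((t + 3) * 'C(N, t.+1) + N * ((t + 3) * 'C(N, t)))
    + ('C(N, t.+1) * (2 * t + 3) + 2 * 'C(2 * t + 6, 3) * 'C(N, t))) < 9 * 'C(N, t.+2).
  by apply: error_ineqs; move: hg'; rewrite nN.
set X := 'C(N, t.+2) in A1 A2 PL *.
have X0 : 0 < X by rewrite bin_gt0; clear -bigN; lia.
rewrite leqNgt; apply/negP => Fbig.
set e1 := (t + 3) * _ + _ in A1 A2; set e2 := _ * (2 * t + 3) + _ in A1 A2.
have hPe : P <= 'C(N - z, t.+2) + e1.
  apply: leq_trans hP _; rewrite -addnA leq_add2l /e1.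
  have -> : t + 3 = t.+3 by lia.
  rewrite leq_add2l; apply: leq_mul => //; rewrite leq_mul2l.
  by apply/orP; right; apply: leq_bin2l; clear -nN zN; lia.
have hFe : F <= F1 + e2.
  apply: leq_trans hF _; rewrite -addnA leq_add2l /e2.
  have -> : 2 * t + 6 = 2 * t.+3 by clear; lia.
  have -> : 2 * t.+3 - 3 = 2 * t + 3 by clear; lia.
  apply: leq_add; first by rewrite leq_mul2r; apply/orP; right; apply: leq_bin2l; clear -nN zN; lia.
  rewrite -[X in _ <= X]mulnA [X in _ <= X]mulnCA leq_mul2l; apply/orP; right.
  have := @bin_shift_half (n - 3) t.+1 t.
  have -> : n - 3 - t.+1 = N by clear -nN; lia.
  apply; first by clear -nN bigN; lia.
  by clear -nN bigN; lia.
clearbody e1 e2.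
(* Otherwise C(z, k - 1) + C(N - z, k - 1) can nearly reach C(N, k - 1) only if N - z is tiny; then
   [P] is small, and so is [F1], by the popularity of x. *)
have zsmall : 10 * z <= N.
  rewrite leqNgt; apply/negP => zbig.
  have [w Nw] : exists w, N = z + w by exists (N - z); clear -zN; lia.
  have Nzw : N - z = w by clear -Nw; lia.
  have r1 := @bin_ratio z N 2 t.+2 zN isT.
  have r2 := @bin_ratio (N - z) N 2 t.+2 (leq_subr _ _) isT.
  rewrite -/X Nzw in r1 r2; rewrite Nzw in hPe.
  have wz : 9 * w < z.
    apply: (@square_split z w X (e1 + e2)) => //; last by clear -zbig Nw; lia.
    rewrite -Nw; apply: (@leq_trans (('C(z, t.+2) + 'C(w, t.+2) + (e1 + e2)) * N ^ 2)).
      by rewrite leq_mul2r; apply/orP; right; move: Fbig hFe hF1 hPe; clear; lia.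
    by rewrite mulnDl leq_add2r mulnDl mulnDr leq_add.
  have h10 := @bin_tenth w N t.+2.
  have {}h10 : 'C(w, t.+2) * 10 ^ t.+2 <= X by apply: h10; clear -wz Nw; lia.
  have := pow_tenth t => p10.
  have : 'C(w, t.+2) * (10 * (2 * t.+3)) <= X.
    apply: leq_trans h10; rewrite leq_mul2l; apply/orP; right.
    by rewrite expnS; clear -p10; lia.
  have : 2 * t.+3 * P <= 2 * t.+3 * ('C(w, t.+2) + e1) by rewrite leq_mul2l hPe orbT.
  have e23 : 2 * t.+3 = 2 * (t + 3) by clear; lia.
  rewrite e23 in hF1' *; move: A2 hF1' Fbig hFe; clear; lia.
(* As 3k >= 9, n is at least 9 C(2k, k); the ninth copy absorbs the difference between n and N - (k
   - 2). *)
have hK8 : 8 * K <= L.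
  have C0 : 0 < 'C(2 * t.+3, t.+3) by rewrite bin_gt0; clear; lia.
  have C20 := @central_bin_bound t.+3 isT.
  have hNC : 8 * 'C(2 * t.+3, t.+3) <= N - t.+1.
    have h9 : 9 * 'C(2 * t.+3, t.+3) <= 3 * t.+3 * 'C(2 * t.+3, t.+3).
      by rewrite leq_mul2r; apply/orP; right; clear; lia.
    have h2 : 2 * t.+3 <= 'C(2 * t.+3, t.+3).
      rewrite -(@leq_pmul2l 81) //; apply: leq_trans C20.
      by rewrite !expnS expn0 muln1; clear; monomials t; lia.
    by move: h9 h2 hn nN; move: ('C(2 * t.+3, t.+3)); clear; lia.
  rewrite -(leq_pmul2r C0); apply: leq_trans hK.
  by rewrite mulnAC mulnC leq_mul2l hNC orbT.
(* It remains to see that [K + E <= L]. If a quarter of the star is lost, [z <= N / 10] suffices: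
   [E <= X / 25 <= 4 L / 25]. *)
case: (leqP X (4 * L)) => XL.
  have := bin_tenth t.+2 zsmall; rewrite -/X => h10.
  have := pow_tenth t => p10.
  have : 'C(z, t.+2) * (25 * (t.+3 + 1)) <= X.
    apply: leq_trans h10; rewrite leq_mul2l; apply/orP; right.
    by rewrite expnS; clear -p10; lia.
  by move: hE hK8 XL PL hF' Fbig; clear; lia.
set D := N - t.+3 - t.+1 in hZ.
set q := _ %/ D in hZ.
set M := 'C(N, t.+1).
have hX := mul_bin_left N t.+1; rewrite -/X -/M in hX.
have D0 : 0 < D by rewrite /D; clear -bigN; lia.
have qD : q * D <= L * t.+2 by apply: leq_divM.
(* With fewer losses the quotient [q] is at most 11/40 of [M], against 36/40 for the binomial it is
   subtracted from; the remaining 25/40 bounds [z] in terms of [L]. *)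
have hq : 40 * q <= 11 * M.
  rewrite -(leq_pmul2r D0).
  have h1 : 10 * (N - t.+1) <= 11 * D by rewrite /D; clear -bigN; lia.
  have : 10 * (N - t.+1) * M <= 11 * D * M by rewrite leq_mul2r h1 orbT.
  have : t.+2 * (4 * L) <= t.+2 * X by rewrite leq_mul2l ltnW // orbT.
  by move: hX qD; clear; lia.
have hC : 9 * M <= 10 * 'C(N - t.+3, t.+1).
  have h1 : t.+3 <= N by clear -bigN; lia.
  have h2 : 10 * (t.+3 * t.+1) <= N by clear -bigN; lia.
  have N0 : 0 < N by clear -bigN; lia.
  have := bin_shift t.+1 h1; rewrite -/M => h3.
  rewrite -(leq_pmul2r N0).
  have : 10 * (t.+3 * t.+1) * M <= N * M by rewrite leq_mul2r h2 orbT.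
  by move: h3; clear; lia.
have hp : 25 * M <= 40 * ('C(N - t.+3, t.+1) - q) by clear -hq hC; lia.
have hzM : z * (25 * M) <= 40 * (L * t.+2).
  apply: leq_trans (_ : z * (40 * ('C(N - t.+3, t.+1) - q)) <= _).
    by rewrite leq_mul2l hp orbT.
  by rewrite mulnCA leq_mul2l hZ orbT.
have hd := mul_bin_diag z t.+1.
have h10 : 'C(z.-1, t.+1) * 10 ^ t.+1 <= M by apply: bin_tenth; clear -zsmall; lia.
have p10 := pow_tenth t.
(* From (k - 1) C(z, k - 1) = z C(z - 1, k - 2) one gets (k - 1) E <= (2/5) z M, and z M <= (40/25)
   (k - 1) L by [hzM]. *)
have : 25 * E <= 16 * L.
  rewrite -(@leq_pmul2l t.+2) //.
  have : t.+2 * E <= t.+2 * ((t.+3 + 1) * 'C(z, t.+2)) by rewrite leq_mul2l hE orbT.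
  have : z * 'C(z.-1, t.+1) * (5 * (t + 4)) <= z * (2 * M).
    rewrite -mulnA leq_mul2l; apply/orP; right.
    apply: leq_trans (_ : 'C(z.-1, t.+1) * (2 * 10 ^ t.+1) <= _).
      by rewrite leq_mul2l p10 orbT.
    by rewrite mulnCA leq_mul2l h10 orbT.
  by rewrite hd; move: hzM; clear; lia.
by move: hK8 XL PL hF' Fbig; clear; lia.
Qed.

(** * The bound *)

Lemma cover2 (V : finType) (A B : {set V}) : cover [set A; B] = A :|: B.
Proof. by rewrite /cover bigcup_setU !big_set1. Qed.

Lemma conditionally_intersecting_triple_free (n s : nat) (F : {set {set 'I_n}}) :
  conditionally_intersecting 3 s F -> triple_free s F.
Proof.
move=> hci A B C U FA FB FC nAB nAC nBC sA sB sC cU e0; apply: hci.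
pose f (i : 'I_3) := if i == 0 :> nat then A else if i == 1 :> nat then B else C.
exists f; split.
- move=> [[|[|[|//]]] i3] [[|[|[|//]]] j3] /=; rewrite /f /= => /eqP;
    rewrite ?(negPf nAB) ?(negPf nAC) ?(negPf nBC) 1?eq_sym
      ?(negPf nAB) ?(negPf nAC) ?(negPf nBC) // => _; exact/val_inj.
- by move=> [[|[|[|//]]] i3].
- apply: leq_trans cU; apply/subset_leq_card/bigcupsP => i _.
  by rewrite /f; case: i => [[|[|[|//]]] i3].
apply/setP => e; rewrite inE; apply/negP => /bigcapP eI.
apply: (e0 e); first exact: (eI (Ordinal (isT : 0 < 3)) isT).
  exact: (eI (Ordinal (isT : 1 < 3)) isT).
exact: (eI (Ordinal (isT : 2 < 3)) isT).
Qed.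

Section Bounds.

Variables (V : finType) (k : nat) (F : {set {set V}}).
Hypotheses (k3 : 3 <= k) (kF : uniform k F) (tF : triple_free (2 * k) F).
Hypothesis no3 : forall A B C, A \in F -> B \in F -> C \in F ->
  [disjoint A & B] -> [disjoint A & C] -> [disjoint B & C] -> False.

Lemma popular_trace (A B : {set V}) : A \in F -> B \in F -> [disjoint A & B] ->
  exists2 x, x \in A :|: B &
  #|[set C in F | #|C :&: (A :|: B)| <= 1]|
    <= 2 * k * #|[set C in F | C :&: (A :|: B) == [set x]]|.
Proof.
move=> FA FB dAB; set F1 := [set C in F | _ <= 1].
case: (boolP [exists x in A :|: B,
    #|F1| <= 2 * k * #|[set C in F | C :&: (A :|: B) == [set x]]|]).
  by case/existsP => x /andP[Wx hx]; exists x.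
move/existsPn => h; exfalso.
have cW : #|A :|: B| = 2 * k.
  by rewrite cardsU (disjoint_setI0 dAB) cards0 !kF //; arith.
(* If every point fails, each one-point trace occurs at most (|F1| - 1) / 2k times; no trace is
   empty, since no three members are pairwise disjoint. *)
have : #|F1| * 1 <= #|A :|: B| * (#|F1|.-1 %/ (2 * k)).
  apply: (double_count (r := fun C x => C :&: (A :|: B) == [set x])) => [C|x Wx].
    rewrite inE => /andP[FC C1].
    have /cards1P[x ex] : #|C :&: (A :|: B)| == 1.
      rewrite eqn_leq C1 card_gt0; apply/negP => /eqP C0.
      have dis (D : {set V}) : D \subset A :|: B -> [disjoint D & C].
        move=> sD; rewrite -setI_eq0; apply/eqP/setP => e; rewrite !inE.
        apply/negP => /andP[/(subsetP sD) De Ce].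
        by move/setP/(_ e): C0; rewrite inE Ce De inE.
      by apply: (no3 FA FB FC dAB); apply: dis; rewrite ?subsetUl ?subsetUr.
    apply/card_gt0P; exists x; rewrite inE ex eqxx andbT.
    by apply: (subsetP (subsetIr C (A :|: B))); rewrite ex inE.
  have := h x; rewrite Wx -ltnNge /= => hx.
  have k0 : 0 < 2 * k by arith.
  rewrite leq_divRL //; apply: (@leq_trans (2 * k * #|[set C in F | C :&: (A :|: B) == [set x]]|)).
    rewrite mulnC leq_mul2l; apply/orP; right; apply/subset_leq_card/subsetP => C.
    by rewrite !inE => /andP[/andP[-> _] ->].
  by case: #|F1| hx.
(* Failure at any one point makes [F1] nonempty, so that its predecessor is strictly smaller. *)
have /card_gt0P[x Ax] : 0 < #|A| by rewrite kF //; arith.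
have := h x; rewrite !inE Ax -ltnNge /= cW => hx.
have := leq_divM #|F1|.-1 (2 * k); rewrite mulnC muln1 => h5 h6.
by arith.
Qed.

Hypothesis hn : 3 * k * 'C(2 * k, k) <= #|V|.

Lemma three_disjoint_bound (A B C : {set V}) : A \in F -> B \in F -> C \in F ->
  [disjoint A & B] -> [disjoint A & C] -> [disjoint B & C] ->
  #|F| <= 'C(#|V| - k - 1, k - 1) + 1.
Proof.
move=> FA FB FC dAB dAC dBC; pose K := [set A; B] :|: [set C].
have sK : K \subset F.
  by apply/subsetP => D; rewrite !inE => /orP[/orP[]|] /eqP->.
have tK : trivIset K.
  apply/trivIsetP => D E; rewrite !inE.
  by do 2![case/orP => [/orP[]|] /eqP->]; rewrite ?eqxx // disjoint_sym.
have cK : #|K| <= 3.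
  apply: card_setU_le (_ : _ <= 2) _; last by rewrite cards1.
  by rewrite cards2; case: (_ != _).
have WE : cover K = A :|: B :|: C by rewrite /cover !bigcup_setU !big_set1.
have cW : #|cover K| = 3 * k.
  rewrite WE cardsU cardsU setIUl (disjoint_setI0 dAB) (disjoint_setI0 dAC).
  by rewrite (disjoint_setI0 dBC) setU0 cards0 !kF //; arith.
have cU : #|~: cover K| = #|V| - 3 * k by have := cardsC (cover K); arith.
have hg := ground_bound k3 hn.
have := card_by_trace k3 kF tF sK tK cK.
have [z zU] := card_trace01 k3 kF tF sK.
rewrite cU in zU *; rewrite cW => h0 h1.
have h2 := shadow_ineq k3 hg zU; have h3 := three_disjoint_ineq k3 hg.
have h4 := leq_trans h0 h2.
apply: leq_trans h1 _; apply: (leq_trans _ (leq_trans h3 (leq_addr 1 _))).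
by rewrite !leq_add2r.
Qed.

Lemma two_disjoint_bound (A B : {set V}) x : A \in F -> B \in F ->
  [disjoint A & B] -> x \in A ->
  #|[set C in F | #|C :&: (A :|: B)| <= 1]|
    <= 2 * k * #|[set C in F | C :&: (A :|: B) == [set x]]| ->
  #|F| <= 'C(#|V| - k - 1, k - 1) + 1.
Proof.
move=> FA FB dAB Ax hx; have xB := disjoint_notin dAB Ax.
pose K := [set A; B]; have WE : cover K = A :|: B by rewrite cover2.
have sK : K \subset F by apply/subsetP => D; rewrite !inE => /orP[] /eqP->.
have tK : trivIset K.
  apply/trivIsetP => D E; rewrite !inE.
  by do 2![case/orP => /eqP->]; rewrite ?eqxx // disjoint_sym.
have cK : #|K| <= 3 by rewrite cards2; case: (_ != _).
have cW : #|cover K| = 2 * k.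
  by rewrite WE cardsU (disjoint_setI0 dAB) cards0 !kF //; arith.
have cU : #|~: cover K| = #|V| - 2 * k by have := cardsC (cover K); arith.
have h1 := card_by_trace k3 kF tF sK tK cK; rewrite cU cW in h1.
have cY := card_outside k3 kF FB xB.
have hP := card_present k3 kF tF x B.
have hK := card_blocked k3 kF tF FB xB.
have hZ := @card_support _ _ _ k3 kF tF x B.
have hPL := card_present_lost k F x B.
have hF := family_cover k3 kF x B.
have hE : #|off_star F x B| <= (k + 1) * 'C(#|off_star_support F x B|, k - 1).
  by apply: card_off_star => // C C' FC FC'; apply: no3.
set Z := off_star_support F x B in hP hZ hE.
have sZ : #|Z| <= #|~: (x |: B)|.
  apply/subset_leq_card/bigcupsP => T; rewrite inE => /and3P[_ xT _].
  apply/subsetP => e; rewrite !inE => /andP[/negPf -> Te]; rewrite orbF.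
  by apply: contraNneq xT => <-.
have hx1 : #|[set C in F | C :&: (A :|: B) == [set x]]| <= #|star_present k F x B|.
  rewrite -(@card_in_imset _ _ (fun C => C :\ x)
             (mem [set C in F | C :&: (A :|: B) == [set x]])).
    apply/subset_leq_card/subsetP => _ /imsetP[C + ->].
    rewrite inE => /andP[FC /eqP eC].
    have Cx : x \in C by apply: (subsetP (subsetIl C (A :|: B))); rewrite eC inE.
    rewrite inE setD1K // FC andbT; apply/andP; split; last first.
      by apply/eqP; have := cardsD1 x C; rewrite Cx kF //; arith.
    apply/subsetP => e; rewrite !inE => /andP[nex Ce]; rewrite (negPf nex) /=.
    apply: contra nex => Be; have : e \in C :&: (A :|: B) by rewrite !inE Ce Be orbT.
    by rewrite eC inE.
  have inC C : C \in [set C in F | C :&: (A :|: B) == [set x]] -> x \in C.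
    rewrite inE => /andP[_ /eqP eC].
    by apply: (subsetP (subsetIl C (A :|: B))); rewrite eC inE.
  by move=> C C' /inC Cx /inC C'x eD; rewrite -(setD1K Cx) eD setD1K.
(* A member counted here has trace exactly [[set x]] if it contains [x]; otherwise it is off-star
   and its rest lies in [Z] and determines it. *)
have h2 : #|[set C in F | #|C :&: cover K| <= 1]|
    <= 'C(#|Z|, k - 1) + #|star_present k F x B|.
  pose E := [set C in F | (#|C :&: cover K| <= 1) && (x \notin C)].
  have hEZ : #|E| <= 'C(#|Z|, k - 1).
    apply: (card_trace1_sub k3 kF tF sK).
      by apply/subsetP => C; rewrite inE => /andP[].
    move=> C; rewrite inE WE => /and3P[FC C1 xC]; split.
      apply/eqP; rewrite eqn_leq C1 card_gt0; apply/negP => /eqP C0.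
      have dis (D : {set V}) : D \subset A :|: B -> [disjoint D & C].
        move=> sD; rewrite -setI_eq0; apply/eqP/setP => e; rewrite !inE.
        apply/negP => /andP[/(subsetP sD) De Ce].
        by move/setP/(_ e): C0; rewrite inE Ce De inE.
      by apply: (no3 FA FB FC dAB); apply: dis; rewrite ?subsetUl ?subsetUr.
    apply: (@subset_trans _ _ (C :\: B)); first by rewrite setDS // subsetUr.
    apply: (bigcup_sup C); rewrite inE FC xC.
    by apply: leq_trans C1; apply/subset_leq_card/setIS/subsetUr.
  apply: leq_trans (card_setU_le hEZ hx1); apply/subset_leq_card/subsetP => C.
  rewrite !inE WE => /andP[-> C1] /=; rewrite C1 /=.
  case: (boolP (x \in C)) => //= Cx; rewrite eq_sym eqEcard cards1 C1 andbT.
  by rewrite sub1set !inE Cx Ax.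
have hx2 : #|[set C in F | #|C :&: cover K| <= 1]| <= 2 * k * #|star_present k F x B|.
  by rewrite WE; apply: leq_trans hx _; rewrite leq_mul2l hx1 orbT.
have k80 : 3 * k + 1 <= #|V|.
  have := ground_bound k3 hn; move: k3; clear.
  case: k => [|[|[|t]]] // _; monomials t; lia.
rewrite -cY; apply: (final_bound _ k3 hn sZ h1 h2 hx2 hP hF hPL) => //.
- by rewrite cY; arith.
- by apply: hK; rewrite cY; arith.
by apply: hZ; rewrite cY; arith.
Qed.

End Bounds.

Theorem theorem1p10 (k n : nat) (hk : 3 <= k) (hn : 3 * k * 'C(2 * k, k) <= n)
    (F : {set {set 'I_n}}) (hF : F \subset ksubsets n k)
    (hci : conditionally_intersecting 3 (2 * k) F)
    (hni : ~ intersecting F) :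
  #|F| <= 'C(n - k - 1, k - 1) + 1.
Proof.
have kF : uniform k F by move=> A /(subsetP hF); rewrite inE => /eqP.
have tF := conditionally_intersecting_triple_free hci.
have hn' : 3 * k * 'C(2 * k, k) <= #|'I_n| by rewrite card_ord.
rewrite -[in X in _ <= X](card_ord n).
case: (boolP [exists A in F, exists B in F, exists C in F,
    [&& [disjoint A & B], [disjoint A & C] & [disjoint B & C]]]).
  case/existsP => A /andP[FA /existsP[B /andP[FB /existsP[C /andP[FC]]]]].
  case/and3P => dAB dAC dBC.
  exact: (three_disjoint_bound hk kF tF hn' FA FB FC dAB dAC dBC).
move=> no3b.
have no3 A B C : A \in F -> B \in F -> C \in F ->
  [disjoint A & B] -> [disjoint A & C] -> [disjoint B & C] -> False.
  move=> FA FB FC dAB dAC dBC; case/negP: no3b.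
  apply/existsP; exists A; rewrite FA; apply/existsP; exists B; rewrite FB.
  by apply/existsP; exists C; rewrite FC dAB dAC dBC.
case: (boolP [exists A in F, exists B in F, [disjoint A & B]]) => [|nd]; last first.
  case: hni => A B FA FB AB0; case/negP: nd.
  apply/existsP; exists A; rewrite FA; apply/existsP; exists B; rewrite FB.
  by rewrite -setI_eq0 AB0 eqxx.
case/existsP => A /andP[FA /existsP[B /andP[FB dAB]]].
have [x + hx] := popular_trace hk kF no3 FA FB dAB.
(* The star misses the one of the two members that does not contain [x]. *)
rewrite inE => /orP[Ax|Bx].
  exact: (two_disjoint_bound hk kF tF no3 hn' FA FB dAB Ax hx).
rewrite (setUC A) in hx; rewrite disjoint_sym in dAB.
exact: (two_disjoint_bound hk kF tF no3 hn' FB FA dAB Bx hx).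
Qed.
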